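(* As $n \rightarrow \infty$, $$(1+o(1)) \cdot \left(\tfrac{n}{2}\right)^{3/2} \leq \mathrm{ar}^{\star}(n,K_5^-) \leq (1+o(1))\,16\cdot \left(\tfrac{n}{2}\right)^{3/2}.$$
   Context: $K_5^-$ is the graph obtained from $K_5$ by removing one edge. A star-colouring of a graph $G$ is an edge-colouring of $G$ in which every colour class is a star (a copy of $K_{1,m}$ with $m\ge 1$, a single edge being allowed). An edge-coloured graph is rainbow if all its edges have different colours. For a graph $H$, $\mathrm{ar}^{\star}(n,H)$ denotes the maximum $s\in\mathbb N$ such that there exists a star-colouring of $K_n$ using exactly $s$ colours and without a rainbow copy of $H$. *)

(* Defs.v *)
From mathcomp Require Import all_boot.
From mathcomp Require Import boolp.

Set Implicit Arguments.
Unset Strict Implicit.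
Unset Printing Implicit Defensive.

(* A finite simple graph on [V], given by its set of edges. *)
Record sgraph (V : finType) := SGraph {
  edges :> {set {set V}};
  card_edge : forall e, e \in edges -> #|e| = 2
}.

Lemma complete_graph_card (n : nat) :
  forall e, e \in [set e : {set 'I_n} | #|e| == 2] -> #|e| = 2.
Proof. by move=> e; rewrite inE => /eqP. Qed.

Definition complete_graph (n : nat) : sgraph 'I_n :=
  SGraph (@complete_graph_card n).

Lemma del_edge_card (V : finType) (G : sgraph V) (e : {set V}) :
  forall f, f \in edges G :\ e -> #|f| = 2.
Proof. by move=> f /setD1P[_ /card_edge]. Qed.

Definition del_edge (V : finType) (G : sgraph V) (e : {set V}) : sgraph V :=
  SGraph (@del_edge_card V G e).

Definition K5_minus : sgraph 'I_5 :=
  del_edge (complete_graph 5) [set inord 0; inord 1].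

(* The edge set of a copy of K_{1,m}, m = #|A| >= 1, with centre v. *)
Definition is_star (V : finType) (F : {set {set V}}) : Prop :=
  exists (v : V) (A : {set V}),
    [/\ A != set0, v \notin A & F = [set [set v; u] | u in A]].

(* An edge-colouring of [G] is a function [c : {set V} -> nat] of which only
   the values on [edges G] matter. *)
Definition colours (V : finType) (G : sgraph V) (c : {set V} -> nat) :
  seq nat := undup [seq c e | e in edges G].

Definition colour_class (V : finType) (G : sgraph V) (c : {set V} -> nat)
    (k : nat) : {set {set V}} := [set e in edges G | c e == k].

Definition star_colouring (V : finType) (G : sgraph V) (c : {set V} -> nat) :
  Prop := forall k, k \in colours G c -> is_star (colour_class G c k).

(* The copy of [H] in [G] is the image of [H] under the embedding [f]. *)
Definition rainbow_copy (V W : finType) (G : sgraph V) (c : {set V} -> nat)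
    (H : sgraph W) (f : W -> V) : Prop :=
  [/\ injective f,
      {in edges H, forall e : {set W}, f @: e \in edges G}
    & {in edges H &, injective (fun e : {set W} => c (f @: e))}].

Definition star_rainbow_free_with (n : nat) (W : finType) (H : sgraph W)
    (s : nat) : Prop :=
  exists c : {set 'I_n} -> nat,
    [/\ star_colouring (complete_graph n) c,
        size (colours (complete_graph n) c) = s
      & ~ exists f : W -> 'I_n, rainbow_copy (complete_graph n) c H f].

(* The range of [s] loses nothing, since a colouring uses at most as many
   colours as there are edges: see [ar_star_ub]. The value is 0 when no
   admissible colouring exists, and attained otherwise. *)
Definition ar_star (n : nat) (W : finType) (H : sgraph W) : nat :=
  \max_(s < #|edges (complete_graph n)|.+1 | `[< star_rainbow_free_with n H s >])
    s.

Lemma ar_star_ub (n : nat) (W : finType) (H : sgraph W) (s : nat) :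
  star_rainbow_free_with n H s -> s <= ar_star n H.
Proof.
move=> Ps; have les : s < #|edges (complete_graph n)|.+1.
  case: Ps => c [_ <- _]; rewrite ltnS /colours.
  by apply: leq_trans (size_undup _) _; rewrite size_image.
by apply: (@leq_bigmax_cond _ _ (fun i => nat_of_ord i) (Ordinal les));
  apply/asboolP.
Qed.

Lemma ar_star_attained (n : nat) (W : finType) (H : sgraph W) (s : nat) :
  star_rainbow_free_with n H s -> star_rainbow_free_with n H (ar_star n H).
Proof.
move=> Ps; have les : s < #|edges (complete_graph n)|.+1.
  case: (Ps) => c [_ <- _]; rewrite ltnS /colours.
  by apply: leq_trans (size_undup _) _; rewrite size_image.
rewrite /ar_star.
rewrite (@bigmax_eq_arg _ (Ordinal les)); last by apply/asboolP.
by case: arg_maxnP => [|i /asboolP]; first exact/asboolP.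
Qed.

(* Main.v *)
Require Import Defs.
From mathcomp Require Import all_boot all_order all_algebra.
From mathcomp Require Import all_classical all_reals all_analysis.
From mathcomp Require Import zify ring lra.
From mathcomp Require finfield.
Import Order.TTheory GRing.Theory Num.Theory.
Import numFieldNormedType.Exports.

Set Implicit Arguments.
Unset Strict Implicit.
Unset Printing Implicit Defensive.

(* Upper bound: pick one edge per colour, directed away from the centre of its
   star.  If two vertices a, a' have four common out-neighbours, discard the one
   (if any) whose arc has the colour of aa'; the three others b1, b2, b3 form a
   triangle, which is not monochromatic, so two of its edges together with aa'
   and the six arcs give a rainbow K_5^-.  Hence all codegrees are at most 3 and
   Cauchy-Schwarz bounds the number s of arcs by s^2 <= 4 n^3.

   Lower bound: in the point-line incidence graph of the affine plane over F_q
   give every edge its own colour, and give every other pair of vertices the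
   colour of its smaller vertex.  Five vertices span at most four edges of a
   bipartite C4-free graph and see at most four of the other colours, while
   K_5^- has nine edges.  This yields q^3 colours as soon as 2 q^2 <= n.

   To have q^3 ~ (n/2)^(3/2) for every n one needs prime powers in (x, (1+c)x]
   for every c > 0 and large x.  By Selberg's formula
     psi(x) ln x + sum_(n <= x) Lambda(n) psi(x/n) = 2 x ln x + O(x)
   no interval is more than about twice as dense in primes as expected, and if
   (x, (1+c)x] contains no prime power then for almost every prime power n (with
   weight Lambda(n)/n) the interval (x/n, (1+c)x/n] has exactly this maximal
   density.  So a non-sparse short interval at z forces maximal density around
   x/z, which in turn forces maximal density at (1+d)z; propagating this along a
   long window contradicts Mertens' estimate
     sum_(n <= x) Lambda(n)/n = ln x + O(1). *)

(** * Upper bound *)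

Lemma pair_in_complete n (a b : 'I_n) :
  ([set a; b] \in edges (complete_graph n)) = (a != b).
Proof. by rewrite inE cards2; case: (a != b). Qed.

Definition K5_minus_pairs : seq (nat * nat) :=
  [:: (0, 2); (0, 3); (0, 4); (1, 2); (1, 3); (1, 4); (2, 3); (2, 4); (3, 4)].

Lemma K5_minus_edgeP (e : {set 'I_5}) : e \in edges K5_minus ->
  exists2 p, p \in K5_minus_pairs & e = [set inord p.1; inord p.2].
Proof.
rewrite in_setD1 inE => /andP[e01 /cards2P[x [y [xy eE]]]].
wlog lxy : x y xy eE / (x < y)%N.
  move=> W; have [|yx|xy'] := ltngtP x y; first exact: W.
    by apply: (W y x) => //; rewrite 1?eq_sym // eE finset.setUC.
  by rewrite (val_inj xy') eqxx in xy.
exists (val x, val y); last by rewrite !inord_val.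
have : ~~ ((val x == 0) && (val y == 1)).
  apply: contra e01 => /andP[/eqP x0 /eqP y1]; apply/eqP; rewrite eE.
  by congr ([set _; _]); apply: val_inj; rewrite /= inordK.
by case: x y lxy {xy eE e01} => [[|[|[|[|[|x]]]]] x5] [[|[|[|[|[|y]]]]] y5].
Qed.

(** Reduces rainbowness to nine explicit colours; the missing edge joins the first two vertices of
    [v]. *)
Lemma rainbow_K5_minus n (c : {set 'I_n} -> nat) (v : seq 'I_n) (v0 : 'I_n) :
  size v = 5 -> uniq v ->
  uniq [seq c [set nth v0 v p.1; nth v0 v p.2] | p <- K5_minus_pairs] ->
  exists f, rainbow_copy (complete_graph n) c K5_minus f.
Proof.
move=> v5 uv uc; pose f (i : 'I_5) := nth v0 v i.
have fi : injective f.
  by move=> i j /eqP; rewrite nth_uniq ?v5 // => /eqP/val_inj.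
have fE p : p \in K5_minus_pairs ->
    f @: [set inord p.1; inord p.2] = [set nth v0 v p.1; nth v0 v p.2].
  move=> pP; have /andP[p1 p2] : (p.1 < 5) && (p.2 < 5).
    by move: p pP; apply/allP.
  by rewrite imsetU1 imset_set1 /f !inordK.
exists f; split=> //.
  move=> e eK; rewrite inE card_imset //.
  by move: eK; rewrite in_setD1 inE => /andP[].
move=> e1 e2 /K5_minus_edgeP[p pP ->] /K5_minus_edgeP[q qP ->].
rewrite !fE // => h; have ij : index p K5_minus_pairs == index q K5_minus_pairs.
  rewrite -(nth_uniq 0 _ _ uc) ?size_map ?index_mem //.
  by rewrite !(nth_map (0, 0)) ?index_mem // !nth_index // h.
by rewrite -(nth_index (0, 0) pP) (eqP ij) nth_index.
Qed.

Section UpperBound.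
Variables (n : nat) (c : {set 'I_n} -> nat).
Hypothesis star_c : star_colouring (complete_graph n) c.
Implicit Types (a b x y z : 'I_n) (p q : 'I_n * 'I_n).

(* [p.1] is the centre and [p.2] a leaf of the star of colour [k]. *)
Definition star_arc k p : bool :=
  [&& p.1 != p.2, c [set p.1; p.2] == k &
      [forall e : {set 'I_n}, (#|e| == 2) && (c e == k) ==> (p.1 \in e)]].

(* [pick] keeps a single arc of each colour. *)
Definition arcs : {set 'I_n * 'I_n} :=
  [set p | [pick q | star_arc (c [set p.1; p.2]) q] == Some p].

Lemma colour_star_arc k : k \in colours (complete_graph n) c ->
  exists p, star_arc k p.
Proof.
move=> kc; have [v [A [A0 vA FE]]] := star_c kc.
have [u uA] := set0Pn _ A0.
have uE : [set v; u] \in colour_class (complete_graph n) c k.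
  by rewrite FE; apply/imsetP; exists u.
move: (uE); rewrite inE => /andP[ue uc]; exists (v, u); apply/and3P; split=> //.
  by move: ue; rewrite pair_in_complete.
apply/forallP=> e; apply/implyP => ek.
have : e \in colour_class (complete_graph n) c k by rewrite !inE.
by rewrite FE => /imsetP[w _ ->]; rewrite !inE eqxx.
Qed.

Lemma arcsP p : p \in arcs -> star_arc (c [set p.1; p.2]) p.
Proof. by rewrite inE; case: pickP => // q + /eqP[qp]; rewrite qp. Qed.

Lemma arcs_colour_inj p q : p \in arcs -> q \in arcs ->
  c [set p.1; p.2] = c [set q.1; q.2] -> p = q.
Proof.
by rewrite !inE => /eqP h1 /eqP h2 h; move: h1; rewrite h h2 => -[].
Qed.

Lemma colours_le_arcs : size (colours (complete_graph n) c) <= #|arcs|.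
Proof.
rewrite cardE -(size_map (fun p => c [set p.1; p.2])).
apply: uniq_leq_size => [|k kc]; first exact: undup_uniq.
have [p0 p0k] := colour_star_arc kc.
case E : [pick q | star_arc k q] => [p|]; last first.
  by move: E; case: pickP => // /(_ p0); rewrite p0k.
have pk : star_arc k p by move: E; case: pickP => // q qk [<-].
have /and3P[_ /eqP ck _] := pk.
apply/mapP; exists p => //; rewrite mem_enum inE ck E eqxx //.
Qed.

(** Hence disjoint edges have different colours and no triangle is monochromatic. *)
Lemma colour_centre (e1 : {set 'I_n}) : e1 \in edges (complete_graph n) ->
  exists v, forall e : {set 'I_n}, #|e| = 2 -> c e = c e1 -> v \in e.
Proof.
move=> e1E; have kc : c e1 \in colours (complete_graph n) c.
  by rewrite mem_undup fintype.image_f.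
have [p /and3P[_ _ /forallP h]] := colour_star_arc kc; exists p.1 => e e2 ce.
by have := h e; rewrite e2 ce !eqxx.
Qed.

(** The copy consists of aa', the six arcs, xz and yz. Distinct arcs have distinct colours; edges of
    the colour of an arc contain its centre, which xz and yz avoid; disjoint edges lie in different
    stars; the hypotheses settle the other pairs. *)
Lemma rainbow_of_centres a a' x y z : a != a' -> uniq [:: x; y; z] ->
  {in [:: x; y; z], forall b, [/\ (a, b) \in arcs, (a', b) \in arcs,
      c [set a; b] != c [set a; a'] & c [set a'; b] != c [set a; a']]} ->
  c [set x; z] != c [set y; z] ->
  exists f, rainbow_copy (complete_graph n) c K5_minus f.
Proof.
move=> aa' uxyz H xyz.
have [ax a'x axa a'xa] := H x (mem_head _ _).
have [|ay a'y aya a'ya] := H y _; first by rewrite !inE eqxx orbT.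
have [|az a'z aza a'za] := H z _; first by rewrite !inE eqxx !orbT.
move: uxyz; rewrite /= !inE negb_or andbT => /andP[/andP[xy xz] yz].
have neq b b' : (b, b') \in arcs -> b != b' by move/arcsP => /and3P[].
have [nax na'x nay na'y] : [/\ a != x, a' != x, a != y & a' != y].
  by split; apply: neq.
have [naz na'z] : a != z /\ a' != z by split; apply: neq.
have arc_arc b1 u1 b2 u2 : (b1, u1) \in arcs -> (b2, u2) \in arcs ->
    (b1 != b2) || (u1 != u2) -> c [set u1; b1] != c [set u2; b2].
  move=> h1 h2; apply: contraTneq; rewrite !(finset.setUC [set u1]) !(finset.setUC [set u2]).
  by move=> h; have [-> ->] := arcs_colour_inj h1 h2 h; rewrite !eqxx.
have arc_far b u v w : (b, u) \in arcs -> v != w -> b != v -> b != w ->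
    c [set u; b] != c [set v; w].
  move=> /arcsP/and3P[_ _ /forallP/(_ [set v; w])].
  move=> H' vw bv bw; apply: contraTneq H' => <-.
  by rewrite cards2 vw /= (finset.setUC [set u]) !inE eqxx (negbTE bv) (negbTE bw).
have far v w v' w' : v != w -> v' != w' -> v != v' -> v != w' -> w != v' -> w != w' ->
    c [set v; w] != c [set v'; w'].
  move=> vw vw' h1 h2 h3 h4; apply/eqP => h.
  have [|u hu] := @colour_centre [set v; w]; first by rewrite pair_in_complete.
  have := hu [set v; w]; have := hu [set v'; w'].
  rewrite !cards2 vw vw' h => /(_ erefl erefl) + /(_ erefl erefl).
  rewrite !inE => /orP[/eqP->|/eqP->].
    by rewrite !(eq_sym v') (negbTE h1) (negbTE h3).
  by rewrite !(eq_sym w') (negbTE h2) (negbTE h4).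
apply: (@rainbow_K5_minus _ _ [:: x; y; z; a; a'] x) => //.
  rewrite /= !inE !negb_or xy xz yz aa' ?(eq_sym x) ?(eq_sym y) ?(eq_sym z).
  by rewrite nax na'x nay na'y naz na'z.
have nxa : x != a by rewrite eq_sym.
have nxa' : x != a' by rewrite eq_sym.
have nza : z != a by rewrite eq_sym.
have nza' : z != a' by rewrite eq_sym.
have nya : y != a by rewrite eq_sym.
have nya' : y != a' by rewrite eq_sym.
rewrite /= !inE !negb_or.
rewrite (finset.setUC [set a]) in axa; rewrite (finset.setUC [set a]) in aya.
rewrite (finset.setUC [set a]) in aza; rewrite (finset.setUC [set a']) in a'xa.
rewrite (finset.setUC [set a']) in a'ya; rewrite (finset.setUC [set a']) in a'za.
repeat (apply/andP; split).
all: try done.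
all: try by apply: arc_far.
all: try by rewrite eq_sym; apply: arc_far.
all: try by apply: far.
all: try by apply: arc_arc; rewrite // ?aa' ?xy ?xz ?yz ?orbT.
Qed.

(** Two edges of the triangle complete the copy unless all three have one colour, and no vertex lies
    on all three of them. *)
Lemma rainbow_of_triple a a' x y z : a != a' ->
  [/\ x != y, y != z & z != x] ->
  {in [:: x; y; z], forall b, [/\ (a, b) \in arcs, (a', b) \in arcs,
      c [set a; b] != c [set a; a'] & c [set a'; b] != c [set a; a']]} ->
  exists f, rainbow_copy (complete_graph n) c K5_minus f.
Proof.
move=> aa' [xy yz zx] H.
have [exz|] := eqVneq (c [set x; z]) (c [set y; z]); last first.
  by apply: rainbow_of_centres H => //=; rewrite !inE negb_or xy yz (eq_sym x z) zx.
have [eyx|] := eqVneq (c [set y; x]) (c [set z; x]); last first.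
  apply: (@rainbow_of_centres a a' y z x) => //=.
    by rewrite !inE negb_or yz zx (eq_sym y x) xy.
  by move=> b bI; apply: H; move: bI; rewrite !inE; do !case: eqP.
have [|u hu] := @colour_centre [set x; z]; first by rewrite pair_in_complete eq_sym.
have := hu [set x; z]; have := hu [set y; z]; have := hu [set y; x].
rewrite !cards2 yz (eq_sym x z) zx (eq_sym y x) xy -exz eyx (finset.setUC [set z]).
move=> /(_ erefl erefl) + /(_ erefl erefl) + /(_ erefl erefl).
rewrite !inE => /orP[] /eqP ->.
  by move=> _; rewrite (eq_sym y x) (negbTE xy) (negbTE yz).
by rewrite (negbTE xy) (eq_sym x z) (negbTE zx).
Qed.

Lemma codegree_le3 a a' : a != a' ->
  ~ (exists f, rainbow_copy (complete_graph n) c K5_minus f) ->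
  #|[set b | ((a, b) \in arcs) && ((a', b) \in arcs)]| <= 3.
Proof.
move=> aa' nr; set B := finset _; rewrite leqNgt; apply/negP => B4; apply: nr.
pose bad b := (c [set a; b] == c [set a; a']) || (c [set a'; b] == c [set a; a']).
have BE b : (b \in B) = ((a, b) \in arcs) && ((a', b) \in arcs) by rewrite finset.in_set.
have bad1 b b' : b \in B -> b' \in B -> bad b -> bad b' -> b = b'.
  rewrite !BE => /andP[h1 h2] /andP[h3 h4] /orP[] /eqP e1 /orP[] /eqP e2.
  - by have [] := arcs_colour_inj h1 h3 (etrans e1 (esym e2)).
  - by have [] := arcs_colour_inj h1 h4 (etrans e1 (esym e2)).
  - by have [] := arcs_colour_inj h2 h3 (etrans e1 (esym e2)).
  - by have [] := arcs_colour_inj h2 h4 (etrans e1 (esym e2)).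
have : 2 < #|[set b in B | ~~ bad b]|.
  have : #|[set b in B | bad b]| <= 1.
    apply/card_le1_eqP => b b'; rewrite [in X in X -> _]finset.in_set [in X in _ -> X -> _]finset.in_set.
    by move=> /andP[bB bb] /andP[b'B bb']; apply: bad1.
  have : #|B| = #|[set b in B | bad b]| + #|[set b in B | ~~ bad b]|.
    rewrite -(cardsID [set b | bad b] B); congr (_ + _); apply: eq_card => b.
      by rewrite !finset.in_set.
    by rewrite !finset.in_set andbC.
  by move: B4; lia.
case/card_gt2P=> x [y [z [[xB yB zB] neq]]].
apply: (@rainbow_of_triple a a' x y z) => // b.
rewrite !in_cons in_nil orbF => bI; have : b \in [set b in B | ~~ bad b].
  by case/or3P: bI => /eqP->.
by rewrite finset.in_set BE /bad negb_or => /andP[/andP[-> ->] /andP[-> ->]].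
Qed.

Lemma sum_sqr_le (d : 'I_n -> nat) : (\sum_b d b) ^ 2 <= n * \sum_b d b ^ 2.
Proof.
rewrite -(leq_pmul2l (isT : 0 < 2)) -mulnn big_distrl /=.
under eq_bigr => b _ do rewrite big_distrr /=.
apply: (@leq_trans (\sum_b \sum_b' (d b ^ 2 + d b' ^ 2))).
  rewrite big_distrr; apply: leq_sum => b _; rewrite big_distrr.
  by apply: leq_sum => b' _; exact: nat_Cauchy.
under eq_bigr => b _ do rewrite big_split /= sum_nat_const card_ord.
by rewrite big_split /= sum_nat_const card_ord -big_distrr /= mul2n -addnn.
Qed.

(** With d(b) the in-degree of b, the sum of d(b)^2 counts common out-neighbours of ordered pairs
    (a, a'). Each a contributes at most n for a' = a and 3 for every other a', in all at most 4
    n^2. *)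
Lemma card_arcs_sqr_le :
  ~ (exists f, rainbow_copy (complete_graph n) c K5_minus f) ->
  #|arcs| ^ 2 <= 4 * n ^ 3.
Proof.
move=> nr; pose d b := \sum_a ((a, b) \in arcs : nat).
have dE : #|arcs| = \sum_b d b.
  rewrite /d exchange_big -sum1_card big_mkcond /=.
  by rewrite (pair_big xpredT xpredT (fun a b => ((a, b) \in arcs : nat))) /=; apply: eq_bigr => -[].
have d2 : \sum_b d b ^ 2 <= 4 * n ^ 2.
  have -> : \sum_b d b ^ 2 = \sum_a \sum_a'
      #|[set b | ((a, b) \in arcs) && ((a', b) \in arcs)]|.
    rewrite (eq_bigr (fun b => \sum_a \sum_a'
       (((a, b) \in arcs) && ((a', b) \in arcs) : nat))); last first.
      move=> b _; rewrite -mulnn big_distrl; apply: eq_bigr => a _.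
      by rewrite big_distrr; apply: eq_bigr => a' _; rewrite /= mulnb.
    rewrite exchange_big; apply: eq_bigr => a _; rewrite exchange_big.
    apply: eq_bigr => a' _; rewrite -sum1_card [RHS]big_mkcond; apply: eq_bigr => b _.
    by rewrite inE; case: (_ && _).
  apply: (@leq_trans (\sum_(a < n) 4 * n)); last first.
    by rewrite sum_nat_const card_ord -mulnn mulnCA.
  apply: leq_sum => a _; rewrite (bigD1 a) //=.
  apply: (@leq_trans (n + \sum_(a' < n | a' != a) 3)).
    apply: leq_add; first by apply: leq_trans (max_card _) _; rewrite card_ord.
    by apply: leq_sum => a' aa'; apply: codegree_le3; rewrite // eq_sym.
  rewrite sum_nat_const mulSn leq_add2l mulnC leq_mul2l /=.
  by apply: leq_trans (max_card _) _; rewrite card_ord.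
rewrite dE; apply: leq_trans (sum_sqr_le _) _.
by rewrite expnS mulnCA leq_mul2l d2 orbT.
Qed.

End UpperBound.

Theorem colours_sqr_le n s : star_rainbow_free_with n K5_minus s ->
  s ^ 2 <= 4 * n ^ 3.
Proof.
case=> c [sc <- nr]; apply: leq_trans (card_arcs_sqr_le sc nr).
by rewrite leq_sqr colours_le_arcs.
Qed.

(** * Colourings from bipartite C4-free graphs *)

Lemma card_K5_minus : #|edges K5_minus| = 9.
Proof.
have := cardsD1 ([set inord 0; inord 1] : {set 'I_5}) (edges (complete_graph 5)).
rewrite pair_in_complete -[#|_ :\ _|]/(#|edges K5_minus|).
have -> : #|edges (complete_graph 5)| = 10 by rewrite card_draws card_ord.
have -> : inord 0 != inord 1 :> 'I_5 by rewrite -val_eqE /= !inordK.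
by move=> [].
Qed.

(* If [P] has two elements, inclusion-exclusion gives at most 3 + 1 edges. *)
Lemma card_small_side (V : finType) (E : {set {set V}}) (P : {set V}) (N : V -> {set V}) :
  #|V| = 5 -> #|P| <= 2 -> {in P, forall x, N x \subset ~: P} ->
  {in P &, forall x x', x != x' -> #|N x :&: N x'| <= 1} ->
  (forall e, e \in E -> exists x y, [/\ x \in P, y \in N x & e = [set x; y]]) ->
  #|E| <= 4.
Proof.
move=> V5 P2 NP Nx EN.
pose S x := [set [set x; y] | y in N x].
have cS x : #|S x| <= #|N x| by exact: leq_imset_card.
have PC : #|P| + #|~: P| = 5 by rewrite cardsC.
have [P0|P1] := posnP #|P|.
  rewrite leqNgt; apply/negP => E4; have : 0 < #|E| by lia.
  case/card_gt0P=> e /EN[x [y [xP _ _]]].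
  by rewrite (cards0_eq P0) finset.in_set0 in xP.
have [P1'|P1'] := leqP #|P| 1.
  have /cards1P[x Px] : #|P| == 1 by rewrite eqn_leq P1 P1'.
  have xP : x \in P by rewrite Px finset.in_set1.
  have -> : 4 = #|~: P| by lia.
  apply: leq_trans (subset_leq_card (NP x xP)); apply: leq_trans (cS x).
  apply: subset_leq_card; apply/fintype.subsetP => e /EN[x' [y [+ yN ->]]].
  by rewrite Px finset.in_set1 => /eqP xx; rewrite -xx; apply: imset_f.
have /cards2P[x [x' [xx Px]]] : #|P| == 2 by rewrite eqn_leq P2 P1'.
have [xP x'P] : x \in P /\ x' \in P by rewrite Px !inE !eqxx orbT.
have h1 : #|N x :|: N x'| <= 3.
  have -> : 3 = #|~: P| by lia.
  by apply: subset_leq_card; rewrite finset.subUset !NP.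
have h2 := Nx x x' xP x'P xx.
have h3 : #|E| <= #|S x :|: S x'|.
  apply: subset_leq_card; apply/fintype.subsetP => e /EN[u [y [+ yN ->]]].
  rewrite Px !inE => /orP[]/eqP uE; apply/orP; [left|right];
  by rewrite -uE; apply: imset_f.
have := cardsUI (S x) (S x'); have := cardsUI (N x) (N x'); have := cS x; have := cS x'.
by lia.
Qed.

Section LowerBound.
Variables (n m : nat) (G : rel nat).
Hypothesis bipartite : forall i j, G i j -> (i < m) && (m <= j).
Hypothesis C4_free : forall i j k l,
  G i k -> G i l -> G j k -> G j l -> i = j \/ k = l.
Implicit Types (a b v w : 'I_n).

(** Edges of [G] are coded in base n and shifted above the vertex colours, which are below n. *)
Definition ordered_colour (p : 'I_n * 'I_n) : nat :=
  if G p.1 p.2 then n + (p.1 * n + p.2) else p.1.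

(** [pick] puts the two ends in increasing order; the default 0 is reached only by sets that are not
    pairs. *)
Definition edge_colour (e : {set 'I_n}) : nat :=
  oapp ordered_colour 0 [pick p : 'I_n * 'I_n | (p.1 < p.2) && (e == [set p.1; p.2])].

Lemma set2_ordered (e : {set 'I_n}) : #|e| = 2 ->
  exists a b, a < b /\ e = [set a; b].
Proof.
move=> /eqP/cards2P[a [b [ab ->]]]; have [lt|gt|eq] := ltngtP a b.
- by exists a, b.
- by exists b, a; rewrite finset.setUC.
- by rewrite (val_inj eq) eqxx in ab.
Qed.

Lemma edge_colourE a b : a < b -> edge_colour [set a; b] = ordered_colour (a, b).
Proof.
move=> ab; rewrite /edge_colour; case: pickP => [[v w] /= /andP[vw /eqP E]|/(_ (a, b))].
  have := set22 v w; have := set21 v w; rewrite -E !inE.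
  have neq : v != w by rewrite -val_eqE neq_ltn vw.
  case/orP=> /eqP vE; case/orP=> /eqP wE; subst v w => //; rewrite ?eqxx // in neq.
  by move: (ltn_trans ab vw); rewrite ltnn.
by rewrite /= ab eqxx.
Qed.

Lemma ordered_colour_inj a b v w :
  ordered_colour (a, b) = ordered_colour (v, w) ->
  a = v /\ (G a b -> b = w).
Proof.
rewrite /ordered_colour /=; have [an vn] := (ltn_ord a, ltn_ord v).
have [bn wn] := (ltn_ord b, ltn_ord w).
case: ifP => ab; case: ifP => vw.
- move/addnI => h; have n0 : 0 < n by exact: leq_ltn_trans an.
  have := congr1 (fun k => k %/ n) h; have := congr1 (fun k => k %% n) h.
  rewrite /= !modnMDl !divnMDl // !modn_small // !divn_small // !addn0.
  by move=> /val_inj -> /val_inj ->.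
- by move=> h; move: vn; rewrite -h ltnNge leq_addr.
- by move=> h; move: an; rewrite h ltnNge leq_addr.
- by move/val_inj.
Qed.

(** The class of an edge of [G] is that edge alone; the class of a vertex v joins v to larger
    vertices only. *)
Lemma edge_colour_star : star_colouring (complete_graph n) edge_colour.
Proof.
move=> k; rewrite mem_undup => /fintype.imageP[e]; rewrite inE => /eqP/set2_ordered.
case=> v [w [vw ->]] ->; rewrite edge_colourE //.
pose A := [set u : 'I_n | (v < u) && (edge_colour [set v; u] == ordered_colour (v, w))].
exists v, A; split.
- by apply/set0Pn; exists w; rewrite inE vw edge_colourE // eqxx.
- by rewrite inE ltnn.
apply/setP => f; apply/idP/imsetP => [|[u]].
  rewrite !inE => /andP[/eqP/set2_ordered[a [b [ab ->]]]].
  rewrite edge_colourE // => /eqP ck; have [av _] := ordered_colour_inj ck.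
  by subst v; exists b; rewrite // inE ab edge_colourE // ck eqxx.
rewrite inE => /andP[vu /eqP ck] ->; rewrite !inE ck eqxx andbT cards2.
by rewrite -val_eqE neq_ltn vu.
Qed.

Lemma edge_colour_rainbow_free :
  ~ exists f : 'I_5 -> 'I_n, rainbow_copy (complete_graph n) edge_colour K5_minus f.
Proof.
case=> f [fi fE fc]; set E := edges K5_minus in fE fc.
pose isG (e : {set 'I_5}) := [exists x, exists y, (e == [set x; y]) && G (f x) (f y)].
have card0 : #|[set e in E | ~~ isG e]| <= 4.
  have [xm xmP] : exists xm, forall x, f x <= f xm.
    exists [arg max_(x > ord0 : 'I_5) (f x : nat)]; case: arg_maxnP => // x _ h y.
    exact: h.
  (* A colour outside [G] is the smaller end of its edge, hence never the largest vertex [xm]; four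
     values remain. *)
  pose l := [seq val (f x) | x <- enum 'I_5 & x != xm].
  have sl : size l = 4.
    rewrite size_map size_filter; apply/(@addnI 1).
    transitivity (count_mem xm (enum 'I_5) + count (fun x => x != xm) (enum 'I_5)).
      by rewrite count_uniq_mem ?enum_uniq // mem_enum.
    by rewrite (count_predC (pred1 xm)) size_enum_ord.
  apply: (@leq_trans (size l)); last by rewrite sl.
  rewrite cardE -(size_map (fun e : {set 'I_5} => edge_colour (f @: e))).
  apply: uniq_leq_size.
    rewrite map_inj_in_uniq ?enum_uniq // => e1 e2.
    by rewrite !mem_enum => /setIdP[h1 _] /setIdP[h2 _]; apply: fc.
  move=> k /mapP[e]; rewrite mem_enum => /setIdP[eE nG] ->.
  have [x [y [exy fxy]]] : exists x y, e = [set x; y] /\ f x < f y.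
    have /cards2P[x [y [xy ->]]] : #|e| == 2 by rewrite (card_edge eE).
    have [lt|gt|eq] := ltngtP (f x) (f y); first by exists x, y.
      by exists y, x; rewrite finset.setUC.
    by rewrite (fi _ _ (val_inj eq)) eqxx in xy.
  apply/mapP; exists x.
    rewrite mem_filter mem_enum andbT; apply: contraTneq fxy => ->.
    by rewrite -leqNgt xmP.
  rewrite exy imsetU1 imset_set1 edge_colourE // /ordered_colour /=.
  case: ifP => // Gxy; case/negP: nG; apply/existsP; exists x.
  by apply/existsP; exists y; rewrite exy eqxx.
have card1 : #|[set e in E | isG e]| <= 4.
  pose P := [set x | f x < m].
  have V5 : #|'I_5| = 5 by rewrite card_ord.
  have PC : #|P| + #|~: P| = 5 by rewrite cardsC.
  have isGP e : e \in [set e in E | isG e] ->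
      exists x y, e = [set x; y] /\ G (f x) (f y).
    move=> /setIdP[_ /existsP[x /existsP[y /andP[/eqP -> Gxy]]]].
    by exists x, y.
  (* One side of the bipartition contains at most two of the five vertices. *)
  have [P2|P3] := leqP #|P| 2.
    apply: (@card_small_side _ _ P (fun x => [set y | G (f x) (f y)])) => //.
    - move=> x _; apply/fintype.subsetP => y; rewrite !inE => /bipartite/andP[_].
      by rewrite -leqNgt.
    - move=> x x' _ _ xx; apply/card_le1_eqP => y y'; rewrite !inE.
      move=> /andP[h1 h2] /andP[h3 h4]; have [h|h] := C4_free h1 h3 h2 h4.
        by rewrite (fi _ _ (val_inj h)) eqxx in xx.
      exact/fi/val_inj.
    - move=> e /isGP[x [y [-> Gxy]]]; exists x, y; rewrite !inE Gxy; split=> //.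
      by have /andP[] := bipartite Gxy.
  apply: (@card_small_side _ _ (~: P) (fun y => [set x | G (f x) (f y)])) => //.
  - by move: PC; lia.
  - move=> y _; apply/fintype.subsetP => x; rewrite !inE => /bipartite/andP[-> _].
    by [].
  - move=> y y' _ _ yy; apply/card_le1_eqP => x x'; rewrite !inE.
    move=> /andP[h1 h2] /andP[h3 h4]; have [h|h] := C4_free h1 h2 h3 h4.
      exact/fi/val_inj.
    by rewrite (fi _ _ (val_inj h)) eqxx in yy.
  - move=> e /isGP[x [y [-> Gxy]]]; exists y, x; rewrite !inE Gxy finset.setUC; split=> //.
    by have /andP[_] := bipartite Gxy; rewrite leqNgt.
have sub : #|E| <= #|[set e in E | isG e] :|: [set e in E | ~~ isG e]|.
  apply: subset_leq_card; apply/fintype.subsetP => e eE.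
  rewrite finset.in_setU; apply/orP.
  by case: (boolP (isG e)) => eG; [left|right]; apply/setIdP.
have := leq_trans sub (leq_card_setU _ _).
by rewrite card_K5_minus => /leq_trans/(_ (leq_add card1 card0)).
Qed.

Lemma star_rainbow_free_bipartite : exists2 s, star_rainbow_free_with n K5_minus s &
  forall (T : finType) (g h : T -> 'I_n),
    (forall i, G (g i) (h i)) -> injective (fun i => (g i, h i)) -> #|T| <= s.
Proof.
exists (size (colours (complete_graph n) edge_colour)).
  exists edge_colour; split=> //; [exact: edge_colour_star|exact: edge_colour_rainbow_free].
move=> T g h Ggh inj.
have lt i : g i < h i by have /andP[h1 h2] := bipartite (Ggh i); exact: leq_trans h2.
rewrite cardE -(size_map (fun i => edge_colour [set g i; h i])).
apply: uniq_leq_size.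
  rewrite map_inj_uniq ?enum_uniq // => i j; rewrite !edge_colourE // => eq.
  have [e1 e2] := ordered_colour_inj eq; apply: inj.
  by rewrite e1 (e2 (Ggh i)).
move=> k /mapP[i _ ->]; rewrite mem_undup fintype.image_f // pair_in_complete.
by rewrite -val_eqE neq_ltn lt.
Qed.

End LowerBound.

(** * Incidence graphs of affine planes *)

Local Open Scope classical_set_scope.
Local Open Scope ring_scope.

Theorem star_rainbow_free_affine_plane (F : finFieldType) (n : nat) :
  (2 * #|F| ^ 2 <= n)%N ->
  exists2 s, star_rainbow_free_with n K5_minus s & (#|F| ^ 3 <= s)%N.
Proof.
move=> qn; pose m := #|{: F * F}|.
have mE : m = (#|F| ^ 2)%N by rewrite /m card_prod mulnn.
(* A line is a pair of slope and intercept, so vertical lines are left out. Points are numbered from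
   0, lines from m. *)
pose G (i j : nat) := [exists p : F * F, exists l : F * F,
  [&& i == enum_rank p :> nat, j == (m + enum_rank l)%N & p.2 == l.1 * p.1 + l.2]].
have GP i j : G i j -> exists p l : F * F,
    [/\ i = enum_rank p, j = (m + enum_rank l)%N & p.2 = l.1 * p.1 + l.2].
  by move=> /existsP[p /existsP[l /and3P[/eqP h1 /eqP h2 /eqP h3]]]; exists p, l.
have bip i j : G i j -> (i < m)%N && (m <= j)%N.
  by move=> /GP[p [l [-> -> _]]]; rewrite ltn_ord leq_addr.
have C4 i j k l : G i k -> G i l -> G j k -> G j l -> i = j \/ k = l.
  move=> /GP[p [u [-> -> e1]]] /GP[p1 [v [/val_inj/enum_rank_inj <- -> e2]]].
  move=> /GP[p' [u1 [-> /addnI/val_inj/enum_rank_inj <- e3]]].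
  move=> /GP[p2 [v1 [/val_inj/enum_rank_inj <- /addnI/val_inj/enum_rank_inj <- e4]]].
  (* Two points on two lines: the incidence equations force equal slopes or equal abscissas, and
     then equal lines or equal points. *)
  have : (u.1 - v.1) * (p.1 - p'.1) = 0.
    have : (u.1 - v.1) * (p.1 - p'.1) = (u.1 * p.1 + u.2 - (v.1 * p.1 + v.2))
      - (u.1 * p'.1 + u.2 - (v.1 * p'.1 + v.2)) by ring.
    by rewrite -e1 -e2 -e3 -e4 !subrr.
  move/eqP; rewrite mulf_eq0 !subr_eq0 => /orP[] /eqP h.
    right; have -> // : u = v.
    by case: u v h e1 e2 {e3 e4} => [u1' u2] [v1' v2] /= -> -> /addrI ->.
  left; have -> // : p = p'.
  by case: p p' h e1 e3 {e2 e4} => [x y] [x' y'] /= -> -> ->.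
have [s sf sT] := star_rainbow_free_bipartite n bip C4; exists s => //.
have pn (p : F * F) : (enum_rank p < n)%N.
  by rewrite (leq_trans (ltn_ord _)) // -/m mE (leq_trans _ qn) // leq_pmull.
have ln (l : F * F) : (m + enum_rank l < n)%N.
  apply: leq_trans qn; rewrite -mE mul2n -addnn ltn_add2l; exact: ltn_ord.
(* [t] consists of slope, intercept and abscissa, which gives q^3 incidences. *)
pose g (t : F * F * F) := Ordinal (pn (t.2, t.1.1 * t.2 + t.1.2)).
pose h (t : F * F * F) := Ordinal (ln t.1).
have := sT {: F * F * F} g h; rewrite !card_prod mulnn -expnSr; apply.
  move=> [[a b] x]; apply/existsP; exists (x, a * x + b).
  by apply/existsP; exists (a, b); rewrite /= !eqxx.
move=> [[a b] x] [[a' b'] x'] [] /val_inj/enum_rank_inj[-> _].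
by move=> /addnI/val_inj/enum_rank_inj[-> ->].
Qed.

(** * Arithmetic functions *)

Lemma sum_dvd (V : nmodType) (h : nat -> V) (d N : nat) : (0 < d)%N ->
  \sum_(1 <= n < N.+1 | (d %| n)%N) h n =
  \sum_(1 <= m < (N %/ d).+1) h (d * m)%N.
Proof.
move=> d0; elim: N => [|N IH]; first by rewrite div0n !big_nil.
rewrite big_mkcond big_nat_recr //= -big_mkcond IH divnS //.
case: ifP => dN; last by rewrite add0n addr0.
rewrite add1n [RHS]big_nat_recr //=; congr (_ + h _).
have -> : (N %/ d).+1 = (N.+1 %/ d)%N by rewrite divnS // dN.
by rewrite mulnC divnK.
Qed.

Lemma sum_hyperbola (V : nmodType) (g : nat -> nat -> V) (N : nat) :
  \sum_(1 <= d < N.+1) \sum_(1 <= m < (N %/ d).+1) g d (d * m)%N =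
  \sum_(1 <= n < N.+1) \sum_(1 <= d < N.+1 | (d %| n)%N) g d n.
Proof.
rewrite (exchange_big_dep_nat xpredT) //=.
apply: eq_big_nat => d /andP[d0 _].
by rewrite sum_dvd.
Qed.

Lemma sum_divisors (V : nmodType) (F : nat -> V) (n N : nat) :
  (0 < n <= N)%N ->
  \sum_(1 <= d < N.+1 | (d %| n)%N) F d = \sum_(d <- divisors n) F d.
Proof.
case/andP=> n0 nN; rewrite -big_filter; apply: perm_big.
apply: uniq_perm; rewrite ?filter_uniq ?iota_uniq ?divisors_uniq // => d.
rewrite mem_filter mem_index_iota -dvdn_divisors //.
case dn: (d %| n)%N => //=.
by rewrite ltnS (dvdn_gt0 n0 dn) (leq_trans (dvdn_leq n0 dn) nN).
Qed.

Section ArithmeticFunctions.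
Variable R : realType.
Implicit Types n m d p N : nat.

Definition moebius n : R :=
  if all (fun p => logn p n == 1%N) (primes n) then (-1) ^+ size (primes n)
  else 0.

Definition mangoldt n : R :=
  if primes n is [:: p] then ln p%:R else 0.

Lemma moebius1 : moebius 1 = 1.
Proof. by rewrite /moebius /= expr0. Qed.

Lemma norm_moebius n : `|moebius n| <= 1.
Proof.
rewrite /moebius; case: ifP => _; last by rewrite normr0.
by rewrite normrX normrN1 expr1n.
Qed.

Lemma moebius_primeM p m : prime p -> (0 < m)%N ->
  moebius (p * m) = if (p %| m)%N then 0 else - moebius m.
Proof.
move=> pp m0; have p0 := prime_gt0 pp.
have lp : logn p (p * m) = (logn p m).+1 by rewrite lognM // logn_prime // eqxx.
case: ifPn => pm.
  rewrite /moebius; case: ifP => // /allP/(_ p).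
  rewrite mem_primes pp muln_gt0 p0 m0 dvdn_mulr //= => /(_ isT).
  by rewrite lp eqSS -leqn0 leqNgt logn_gt0 mem_primes pp m0 pm.
have perm : perm_eq (primes (p * m)) (p :: primes m).
  apply: uniq_perm; rewrite /= ?primes_uniq //.
    by rewrite mem_primes pp m0 (negbTE pm).
  move=> q; rewrite primesM // inE; congr (_ || _).
  by rewrite primes_prime // inE.
rewrite /moebius (perm_all _ perm) (perm_size perm) /= lp.
have -> : logn p m = 0%N.
  by apply/eqP; rewrite -leqn0 leqNgt logn_gt0 mem_primes pp m0.
rewrite eqxx /=.
have -> : all (fun q => logn q (p * m) == 1%N) (primes m) =
          all (fun q => logn q m == 1%N) (primes m).
  apply: eq_in_all => q; rewrite mem_primes => /and3P[qp _ qm].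
  rewrite lognM // logn_prime //; case: (q =P p) => [qp'|] //.
  by rewrite -qp' qm in pm.
by case: ifP => _; rewrite ?oppr0 // exprS mulN1r.
Qed.

(** For a prime p dividing n, a divisor pe contributes - mu(e) if p does not divide e and 0
    otherwise, so these cancel the divisors prime to p. *)
Lemma sum_moebius n N : (0 < n <= N)%N ->
  \sum_(1 <= d < N.+1 | (d %| n)%N) moebius d = (n == 1%N)%:R.
Proof.
case/andP=> n0 nN; case: eqP => [->|n1].
  rewrite sum_divisors ?(leq_trans n0 nN) //.
  by rewrite (_ : divisors 1 = [:: 1%N]) // big_seq1 moebius1.
have {n1} n1 : (1 < n)%N by rewrite ltn_neqAle eq_sym n0 andbT; apply/eqP.
have pp := pdiv_prime n1; have pn := pdiv_dvd n; move: (pdiv n) pp pn => p pp pn.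
have p0 := prime_gt0 pp.
rewrite (bigID (fun d => (p %| d)%N)) /=.
have -> : \sum_(1 <= d < N.+1 | (d %| n)%N && (p %| d)%N) moebius d =
  - \sum_(1 <= d < N.+1 | (d %| n)%N && ~~ (p %| d)%N) moebius d.
  transitivity (\sum_(1 <= e < (N %/ p).+1)
      if (p * e %| n)%N then moebius (p * e) else 0).
    rewrite -(@sum_dvd _ (fun d => if (d %| n)%N then moebius d else 0)) //.
    by rewrite -[RHS]big_mkcondr /=; apply: eq_bigl => d; rewrite andbC.
  rewrite -sumrN [RHS]big_mkcond /=.
  rewrite [RHS](@big_cat_nat _ _ _ (N %/ p).+1) //=; last by rewrite ltnS leq_div.
  rewrite [X in _ = _ + X]big1_seq ?addr0; last first.
    move=> d /andP[_]; rewrite mem_index_iota => /andP[d1 d2].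
    case: ifP => // /andP[dn pd].
    have : (p * d %| n)%N by rewrite Gauss_dvd ?pn ?prime_coprime.
    move/(dvdn_leq n0) => h; exfalso.
    have : (N < p * d)%N by rewrite mulnC -ltn_divLR.
    by rewrite ltnNge (leq_trans h).
  apply: eq_big_nat => d /andP[d0 _]; rewrite moebius_primeM //.
  case: (boolP (p %| d)%N) => pd /=; first by rewrite andbF; case: ifP.
  by rewrite Gauss_dvd ?prime_coprime // pn andbT.
by rewrite addNr.
Qed.

Lemma mangoldt_ge0 n : 0 <= mangoldt n.
Proof.
rewrite /mangoldt; case E: (primes n) => [|p []] //.
apply: ln_ge0; rewrite ler1n.
by have : p \in primes n by [rewrite E mem_head]; rewrite mem_primes => /andP[/prime_gt0].
Qed.

Lemma mangoldt_le n : (0 < n)%N -> mangoldt n <= ln n%:R.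
Proof.
move=> n0; rewrite /mangoldt; have l0 : 0 <= ln n%:R :> R by rewrite ln_ge0 ?ler1n.
case E: (primes n) => [|p []] //.
have : p \in primes n by rewrite E mem_head.
rewrite mem_primes => /and3P[pp _ pn].
have p0 := prime_gt0 pp.
by rewrite ler_ln ?posrE ?ltr0n // ler_nat dvdn_leq.
Qed.

Lemma mangoldt_neq0 n : mangoldt n != 0 ->
  exists p k, [/\ prime p, (0 < k)%N & n = (p ^ k)%N].
Proof.
rewrite /mangoldt; case E: (primes n) => [|p []]; rewrite ?eqxx // => _.
have : p \in primes n by rewrite E mem_head.
rewrite mem_primes => /and3P[pp n0 pn].
exists p, (logn p n); split => //; first by rewrite logn_gt0 mem_primes pp n0.
rewrite {1}(prod_prime_decomp n0) prime_decompE E /= big_seq1 //.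
Qed.

Lemma mangoldt_pfactor p k : prime p -> (0 < k)%N -> mangoldt (p ^ k) = ln p%:R.
Proof. by move=> pp k0; rewrite /mangoldt primesX // primes_prime. Qed.

(** Induction: for n = m p, the only divisor of n that does not divide m and has nonzero weight is
    the exact power of p in n, of weight ln p. *)
Lemma sum_mangoldt n N : (0 < n <= N)%N ->
  \sum_(1 <= d < N.+1 | (d %| n)%N) mangoldt d = ln n%:R.
Proof.
elim/ltn_ind: n => n IH /andP[n0 nN].
have [n1|n1] := leqP n 1.
  have -> : n = 1%N by apply/eqP; rewrite eqn_leq n1 n0.
  rewrite sum_divisors ?(leq_trans n0 nN) //.
  by rewrite (_ : divisors 1 = [:: 1%N]) // big_seq1 ln1.
have pp := pdiv_prime n1; have pn := pdiv_dvd n; move: (pdiv n) pp pn => p pp pn.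
have p0 := prime_gt0 pp.
case/dvdnP: pn => m nE; have m0 : (0 < m)%N by move: n0; rewrite nE muln_gt0 => /andP[].
have mn : (m < n)%N by rewrite nE ltn_Pmulr ?prime_gt1.
rewrite (bigID (fun d => (d %| m)%N)) /=.
rewrite (eq_bigl (fun d => (d %| m)%N)); last first.
  by move=> d; rewrite andbC; case: (boolP (d %| m)%N) => // dm; rewrite nE dvdn_mulr.
rewrite IH ?m0 ?(leq_trans (ltnW mn) nN) //.
set k := logn p n.
have k0 : (0 < k)%N by rewrite logn_gt0 mem_primes pp n0 nE dvdn_mull.
have km : k = (logn p m).+1 by rewrite /k nE lognM // (logn_prime p pp) eqxx addn1.
rewrite big_mkcond /= (bigD1_seq (p ^ k)%N) ?iota_uniq //=; last first.
  by rewrite mem_index_iota ltnS expn_gt0 p0 (leq_trans _ nN) // dvdn_leq // pfactor_dvdnn.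
rewrite pfactor_dvdnn pfactor_dvdn // km ltnn /= -km mangoldt_pfactor //.
rewrite big1_seq ?addr0.
  by rewrite -lnM ?posrE ?ltr0n // nE natrM.
move=> d /andP[dk]; rewrite mem_index_iota => /andP[d0 _]; case: ifP => // /andP[dn dm].
apply/eqP; apply: contraT => /mangoldt_neq0[q [j [qp j0 dE]]]; exfalso.
move: dn dm dk; rewrite dE !pfactor_dvdn // nE lognM // (logn_prime q pp).
case: (q =P p) => [->|_]; last by rewrite addn0 => ->.
rewrite addn1 -km => jk; rewrite -ltnNge => mj /eqP; apply.
by congr (_ ^ _)%N; apply/eqP; rewrite eqn_leq jk km mj.
Qed.

(** Moebius inversion: expand ln (n / d) over the divisors e of n / d; the sum of [moebius] over the
    divisors of n / e leaves only e = n. *)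
Lemma sum_moebius_ln n N : (0 < n <= N)%N ->
  \sum_(1 <= d < N.+1 | (d %| n)%N) moebius d * ln (n %/ d)%:R = mangoldt n.
Proof.
case/andP=> n0 nN.
transitivity (\sum_(1 <= d < N.+1 | (d %| n)%N)
   \sum_(1 <= e < N.+1 | (e %| n %/ d)%N) moebius d * mangoldt e).
  rewrite big_nat_cond [RHS]big_nat_cond; apply: eq_bigr => d /andP[/andP[d0 _] dn].
  rewrite -big_distrr /= sum_mangoldt // divn_gt0 // dvdn_leq //=.
  by rewrite (leq_trans (leq_div _ _)).
rewrite (exchange_big_dep (fun e => (e %| n)%N)) /=; last first.
  by move=> d e dn en; rewrite (dvdn_trans en) // -{2}(divnK dn) dvdn_mulr.
transitivity (\sum_(1 <= e < N.+1 | (e %| n)%N) mangoldt e * (n == e)%:R).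
  rewrite big_nat_cond [RHS]big_nat_cond; apply: eq_bigr => e /andP[/andP[e0 _] en].
  have ne0 : (0 < n %/ e)%N by rewrite divn_gt0 // dvdn_leq.
  have -> : (n == e) = (n %/ e == 1)%N.
    by rewrite [RHS]eq_sym eqn_div // mul1n eq_sym.
  rewrite -(@sum_moebius _ N); last by rewrite ne0 (leq_trans (leq_div _ _)).
  rewrite big_distrr /= big_nat_cond [RHS]big_nat_cond.
  apply: eq_big => [d|d _]; last by rewrite mulrC.
  case: (posnP d) => //= d0; congr (_ && _).
  case: (boolP (d %| n)%N) => dn /=; first by rewrite !dvdn_divRL // mulnC.
  apply/esym/negbTE; apply: contra dn => /dvdn_trans; apply.
  by rewrite -{2}(divnK en) dvdn_mulr.
rewrite big_mkcond (bigD1_seq n) ?iota_uniq ?mem_index_iota ?n0 ?ltnS //=.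
rewrite dvdnn eqxx mulr1 big1 ?addr0 // => e; rewrite eq_sym => /negbTE->.
by rewrite mulr0; case: ifP.
Qed.

End ArithmeticFunctions.

(** * Chebyshev and Mertens estimates *)

Lemma sum_divisors_flip (V : nmodType) (F : nat -> V) (n N : nat) :
  (0 < n <= N)%N ->
  \sum_(1 <= d < N.+1 | (d %| n)%N) F (n %/ d)%N =
  \sum_(1 <= d < N.+1 | (d %| n)%N) F d.
Proof.
move=> nN; have n0 : (0 < n)%N by case/andP: nN.
rewrite (@sum_divisors _ (fun d => F (n %/ d)%N)) // sum_divisors //.
rewrite -(big_map (fun d => n %/ d)%N xpredT F); apply: perm_big.
have inv d : d \in divisors n -> (n %/ (n %/ d) = d)%N.
  rewrite -dvdn_divisors // => dn.
  by rewrite divnA // mulKn.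
apply: uniq_perm; rewrite ?divisors_uniq ?map_inj_in_uniq ?divisors_uniq //.
  by move=> d e dn en /= de; rewrite -(inv d dn) de inv.
move=> d; apply/mapP/idP => [[e en ->]|dn].
  by move: en; rewrite -!dvdn_divisors // => en; rewrite dvdn_div.
exists (n %/ d)%N; last by rewrite inv.
by move: dn; rewrite -!dvdn_divisors // => dn; rewrite dvdn_div.
Qed.

Section Chebyshev.
Variable R : realType.
Implicit Types n m d p N M : nat.

Lemma ln_le_subr1 (x : R) : 0 < x -> ln x <= x - 1.
Proof.
move=> x0; have := @le_ln1Dx R (x - 1); rewrite [1 + _]addrC subrK; apply; lra.
Qed.

Lemma ln_ge_subV (x : R) : 0 < x -> 1 - x^-1 <= ln x.
Proof.
move=> x0; have := @ln_le_subr1 x^-1; rewrite invr_gt0 lnV ?posrE // => /(_ x0).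
lra.
Qed.

Lemma ln_succ n : (0 < n)%N ->
  n.+1%:R^-1 <= ln (n.+1%:R : R) - ln n%:R <= n%:R^-1.
Proof.
move=> n0; have np : 0 < n%:R :> R by rewrite ltr0n.
have n1p : 0 < n.+1%:R :> R by rewrite ltr0n.
rewrite -ln_div ?posrE //.
have qp : 0 < n.+1%:R / n%:R :> R by rewrite divr_gt0.
have nS : n.+1%:R = n%:R + 1 :> R by rewrite -natr1.
apply/andP; split.
  apply: le_trans _ (ln_ge_subV qp); rewrite invf_div nS.
  by rewrite le_eqVlt; apply/orP; left; apply/eqP; field; lra.
apply: le_trans (ln_le_subr1 qp) _; rewrite nS.
by rewrite le_eqVlt; apply/orP; left; apply/eqP; field; lra.
Qed.

Definition ln_fact N : R := \sum_(1 <= n < N.+1) ln n%:R.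
Definition chebyshev_psi N : R := \sum_(1 <= n < N.+1) mangoldt R n.
Definition mertens_sum N : R := \sum_(1 <= n < N.+1) mangoldt R n / n%:R.
Definition harmonic_sum N : R := \sum_(1 <= n < N.+1) n%:R^-1.

Local Notation T := ln_fact.
Local Notation psi := chebyshev_psi.

Lemma ln_factS N : T N.+1 = T N + ln N.+1%:R.
Proof. by rewrite /T big_nat_recr. Qed.

Lemma stirling N : (0 < N)%N ->
  N%:R * ln N%:R - N%:R + 1 <= T N <= N%:R * ln N%:R - N%:R + 1 + ln N%:R.
Proof.
case: N => // N _; elim: N => [|N /andP[IH1 IH2]].
  by rewrite /T big_nat1 ln1; lra.
have /andP[] := @ln_succ N.+1 isT.
rewrite ln_factS; set a := ln N.+1%:R in IH1 IH2 *; set b := ln N.+2%:R.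
have np : 0 < N.+1%:R :> R by rewrite ltr0n.
have n1p : 0 < N.+2%:R :> R by rewrite ltr0n.
rewrite -div1r ler_pdivrMr // -[X in _ -> _ <= X -> _]div1r ler_pdivlMr //.
have -> : N.+2%:R = N.+1%:R + 1 :> R by rewrite -natr1.
by move=> h1 h2; apply/andP; split; nra.
Qed.

(** gamma is Euler's constant, enclosed between the increasing H(N) - ln (N + 1) and the decreasing
    H(N + 1) - ln (N + 1). *)
Lemma harmonic_bounds : exists gamma : R, 0 <= gamma <= 1 /\
  forall N, (0 < N)%N -> 0 <= harmonic_sum N - ln N%:R - gamma <= N%:R^-1.
Proof.
pose a N : R := harmonic_sum N.+1 - ln N.+1%:R.
pose b N : R := harmonic_sum N - ln N.+1%:R.
have aS N : a N.+1 <= a N.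
  rewrite /a {1}/harmonic_sum big_nat_recr //= -/(harmonic_sum N.+1).
  have /andP[] := @ln_succ N.+1 isT.
  by move: (N.+2%:R^-1 : R) (N.+1%:R^-1 : R) => u v; lra.
have bS N : b N <= b N.+1.
  rewrite /b {2}/harmonic_sum big_nat_recr //= -/(harmonic_sum N).
  have /andP[] := @ln_succ N.+1 isT.
  by move: (N.+2%:R^-1 : R) (N.+1%:R^-1 : R) => u v; lra.
have ab N : b N <= a N.
  rewrite /a /b {2}/harmonic_sum big_nat_recr //= -/(harmonic_sum N).
  have : 0 <= (N.+1%:R : R)^-1 by [].
  by move: (N.+1%:R^-1 : R) => u; lra.
have ba N M : b N <= a M.
  have h1 : b N <= b (N + M)%N.
    by elim: M => [|M IH]; rewrite ?addn0 // addnS (le_trans IH).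
  have h2 : a (M + N)%N <= a M.
    by elim: N {h1} => [|N IH]; rewrite ?addn0 // addnS (le_trans _ IH).
  by apply: le_trans h1 (le_trans (ab _) _); rewrite addnC.
pose B := [set b N | N in setT].
have hs : has_sup B.
  split; first by exists (b 0%N); exists 0%N.
  by exists (a 0%N) => _ [N _ <-].
have lb N : b N <= sup B by apply: ub_le_sup; [case: hs | exists N].
have ub N : sup B <= a N by apply: ge_sup; [case: hs | move=> _ [M _ <-]].
exists (sup B); split.
  have := lb 0%N; have := ub 0%N.
  by rewrite /a /b /harmonic_sum big_nat1 big_nil ln1; lra.
case=> // N _; have := ub N; have := lb N.+1.
have /andP[] := @ln_succ N.+1 isT; move: (N.+2%:R^-1 : R) (N.+1%:R^-1 : R) => u v.
by rewrite /a /b; lra.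
Qed.

(** Legendre's formula: d divides N / d, rounded down, of the factors of N!. *)
Lemma ln_fact_mangoldt N :
  T N = \sum_(1 <= d < N.+1) mangoldt R d * (N %/ d)%:R.
Proof.
rewrite /T.
transitivity (\sum_(1 <= n < N.+1) \sum_(1 <= d < N.+1 | (d %| n)%N) mangoldt R d).
  by apply: eq_big_nat => n /andP[n0 nN]; rewrite sum_mangoldt // n0.
rewrite -(@sum_hyperbola _ (fun d _ => mangoldt R d)).
apply: eq_big_nat => d _; rewrite big_const_nat subSS subn0 iter_addr_0.
by rewrite mulr_natr.
Qed.

Lemma sum_psi_div N : \sum_(1 <= m < N.+1) psi (N %/ m)%N = T N.
Proof.
transitivity (\sum_(1 <= m < N.+1) \sum_(1 <= d < (N %/ m).+1)
    mangoldt R ((m * d) %/ m)).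
  apply: eq_big_nat => m /andP[m0 _]; apply: eq_bigr => d _.
  by rewrite mulKn.
rewrite (@sum_hyperbola _ (fun m n => mangoldt R (n %/ m))) /T.
apply: eq_big_nat => n /andP[n0 nN].
by rewrite sum_divisors_flip ?n0 // sum_mangoldt // n0.
Qed.

Lemma psi_ge0 N : 0 <= psi N.
Proof. by apply: sumr_ge0 => n _; exact: mangoldt_ge0. Qed.

(** T(2M) - 2 T(M), the logarithm of a central binomial coefficient, gives [mangoldt] a nonnegative
    weight at every d, and weight at least 1 for M < d <= 2M. It grows by at most 2 ln 2 when M
    grows by 1. *)
Lemma psi_double M : psi M.*2 - psi M <= 3 * M%:R.
Proof.
have h1 : psi M.*2 - psi M <= T M.*2 - 2 * T M.
  rewrite !ln_fact_mangoldt /psi.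
  have MM : (M <= M.*2)%N by rewrite -addnn leq_addr.
  rewrite [X in X - _ <= _](@big_cat_nat _ _ _ M.+1) //= addrAC subrr.
  rewrite [X in _ <= X - _](@big_cat_nat _ _ _ M.+1) //=.
  rewrite big_distrr /= addrAC -sumrB; apply: lerD.
    rewrite big_nat; apply: sumr_ge0 => d /andP[d0 _].
    have : (2 * (M %/ d) <= M.*2 %/ d)%N.
      by rewrite leq_divRL // -mul2n -mulnA leq_mul2l leq_divM.
    rewrite -(ler_nat R) natrM => h; have := mangoldt_ge0 R d; nra.
  rewrite big_nat [X in _ <= X]big_nat; apply: ler_sum => d /andP[d1 d2].
  rewrite -[X in X <= _]mulr1 ler_wpM2l ?mangoldt_ge0 // ler1n divn_gt0 //.
  by rewrite (leq_trans _ d1).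
apply: le_trans h1 _; elim: M => [|M IH]; first by rewrite /T big_nil mulr0 subrr mulr0.
rewrite doubleS !ln_factS.
suff : ln (M.*2.+2)%:R - ln M.+1%:R + (ln (M.*2.+1)%:R - ln M.+1%:R) <= 3 :> R.
  by rewrite -natr1; lra.
rewrite -!ln_div ?posrE ?ltr0n //.
have np : 0 < M.+1%:R :> R by rewrite ltr0n.
have q1 : M.*2.+2%:R / M.+1%:R = 2 :> R.
  by rewrite -doubleS -muln2 natrM mulrC mulKf // lt0r_neq0.
have : ln (M.*2.+1%:R / M.+1%:R) <= ln 2 :> R.
  rewrite ler_ln ?posrE ?divr_gt0 ?ltr0n // -q1 ler_pM2r ?invr_gt0 //.
  by rewrite ler_nat.
rewrite q1; have := @ln_le_subr1 2 (ltr0Sn _ _); lra.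
Qed.

Lemma psi_le N : psi N <= 5 * N%:R.
Proof.
elim/ltn_ind: N => N IH; case: (posnP N) => [->|N0].
  by rewrite /psi big_nil mulr0.
rewrite -(odd_double_half N).
have hl : (N./2 < N)%N by rewrite -divn2 ltn_Pdiv.
have := IH _ hl; have := psi_double N./2; move: (N./2) => M.
case: (odd N) => /=.
  rewrite add1n /psi [X in _ -> _ -> X <= _]big_nat_recr //= -/(psi _).
  have := @mangoldt_le R M.*2.+1 isT; have := @ln_le_subr1 M.*2.+1%:R (ltr0Sn _ _).
  by rewrite -natr1 -muln2 natrM -/(psi _); lra.
by rewrite add0n -muln2 natrM; have := ler0n R M; lra.
Qed.

Lemma ln_nat_ge0 n : 0 <= ln n%:R :> R.
Proof. by case: n => [|n]; [rewrite ln0 | rewrite ln_ge0 // ler1n]. Qed.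

(** Dropping the rounding in Legendre's formula costs between 0 and psi(N) = O(N); Stirling's bounds
    evaluate ln N!. *)
Lemma mertens N : (0 < N)%N -> `|mertens_sum N - ln N%:R| <= 5.
Proof.
move=> N0; have Np : 0 < N%:R :> R by rewrite ltr0n.
have h : 0 <= N%:R * mertens_sum N - T N <= psi N.
  rewrite ln_fact_mangoldt /mertens_sum big_distrr /= -sumrB /psi.
  have D d : (0 < d)%N -> 0 <= (N%:R : R) / d%:R - (N %/ d)%:R <= 1.
    move=> d0; have dp : 0 < d%:R :> R by rewrite ltr0n.
    rewrite {1 3}(divn_eq N d) natrD natrM mulrDl mulfK ?lt0r_neq0 //.
    rewrite addrAC subrr add0r divr_ge0 //= ler_pdivrMr // mul1r ler_nat.
    by rewrite ltnW // ltn_pmod.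
  apply/andP; split.
    rewrite big_nat; apply: sumr_ge0 => d /andP[d0 _].
    by have := D d d0; have := mangoldt_ge0 R d; nra.
  rewrite big_nat [X in _ <= X]big_nat; apply: ler_sum => d /andP[d0 _].
  by have := D d d0; have := mangoldt_ge0 R d; nra.
have := stirling N0; have := psi_le N.
have : ln N%:R <= N%:R - 1 :> R by rewrite ln_le_subr1.
have := ln_nat_ge0 N.
case/andP: h; set A := mertens_sum N; set l := ln _; set t := T N; set s := psi N.
move=> h1 h2 l0 l1 s5 /andP[t1 t2].
rewrite ler_norml; apply/andP; split.
  rewrite -(ler_pM2l Np); nra.
rewrite -(ler_pM2l Np); nra.
Qed.

End Chebyshev.

(** * Selberg's formula *)

Section Selberg.
Variable R : realType.
Implicit Types n m d N M : nat.
Local Notation Lam := (mangoldt R).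
Local Notation psi := (chebyshev_psi R).

Lemma sum_invsqrt N :
  \sum_(1 <= d < N.+1) (Num.sqrt d%:R : R)^-1 <= 2 * Num.sqrt N%:R.
Proof.
elim: N => [|N IH]; first by rewrite big_nil mulr_ge0 // sqrtr_ge0.
rewrite big_nat_recr //=; apply: le_trans (lerD IH (lexx _)) _.
set a : R := Num.sqrt N%:R; set b : R := Num.sqrt N.+1%:R.
have a0 : 0 <= a by exact: sqrtr_ge0.
have b0 : 0 < b by rewrite sqrtr_gt0 ltr0n.
have ab : b ^+ 2 = a ^+ 2 + 1 by rewrite !sqr_sqrtr ?ler0n // -natr1.
rewrite -lerBrDl -div1r ler_pdivrMr //.
have := sqr_ge0 (b - a); nra.
Qed.

(** At y = N / d this majorant sums to O(N) over d, by [sum_invsqrt]. It follows from ln u <= u - 1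
    at the fourth root u of y. *)
Lemma ln_quadratic_sqrt (y : R) : 1 <= y -> ln y * (2 + ln y) <= 16 * Num.sqrt y.
Proof.
move=> y1; have y0 : 0 < y by lra.
set u := Num.sqrt (Num.sqrt y).
have u0 : 0 < u by rewrite !sqrtr_gt0.
have u2 : u ^+ 2 = Num.sqrt y by rewrite sqr_sqrtr // sqrtr_ge0.
have -> : ln y = 4 * ln u.
  have -> : y = u ^+ 4 by rewrite (exprM u 2 2) u2 sqr_sqrtr // ltW.
  by rewrite lnXn // mulr_natl.
have sqrt_ge1 (x : R) : 1 <= x -> 1 <= Num.sqrt x.
  by move=> x1; rewrite -(sqrtr1 R) ler_sqrt // (le_trans ler01).
have u1 : 1 <= u by rewrite !sqrt_ge1.
have := ln_le_subr1 u0; have := ln_ge0 u1; rewrite -u2 => l0 l1; nra.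
Qed.

(* Selberg's formula follows by taking [f k = psi (N / k) - N / k + gamma + 1],
   whose inner sums are [O(1 + ln (N / d))]. *)
Lemma tatuzawa_iseki (f : nat -> R) N : (0 < N)%N ->
  f 1%N * ln N%:R + \sum_(1 <= n < N.+1) Lam n * f n =
  \sum_(1 <= d < N.+1) moebius R d * ln (N%:R / d%:R) *
    \sum_(1 <= m < (N %/ d).+1) f (d * m)%N.
Proof.
move=> N0; under [RHS]eq_bigr => d _ do rewrite big_distrr /=.
rewrite (@sum_hyperbola _ (fun d n => moebius R d * ln (N%:R / d%:R) * f n)).
(* ln (N / d) = ln (N / n) + ln (n / d): the divisor sum of the first part is concentrated at n = 1,
   that of the second is [Lam n]. *)
transitivity (\sum_(1 <= n < N.+1) f n * (ln (N%:R / n%:R) * (n == 1%N)%:R + Lam n)).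
  under [RHS]eq_bigr => n _ do rewrite mulrDr.
  rewrite big_split /=; congr (_ + _); last by apply: eq_bigr => n _; rewrite mulrC.
  rewrite (bigD1_seq 1%N) ?iota_uniq ?mem_index_iota //= divr1 mulr1 big1 ?addr0 //.
  by move=> n /negbTE->; rewrite !mulr0.
apply: eq_big_nat => n /andP[n0 nN].
rewrite -(@sum_moebius R n N) ?n0 // -(@sum_moebius_ln R n N) ?n0 //.
rewrite !big_distrr /= -big_split /= big_distrr /=.
rewrite big_nat_cond [RHS]big_nat_cond; apply: eq_bigr => d /andP[/andP[d0 _] dn].
have nd0 : (0 < n %/ d)%N by rewrite divn_gt0 // dvdn_leq.
have -> : N%:R / d%:R = N%:R / n%:R * (n %/ d)%:R :> R.
  have -> : n%:R = (n %/ d)%:R * d%:R :> R by rewrite -natrM divnK.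
  have : (n %/ d)%:R != 0 :> R by rewrite pnatr_eq0 -lt0n.
  have : d%:R != 0 :> R by rewrite pnatr_eq0 -lt0n.
  by move=> h1 h2; field; rewrite h1 h2.
rewrite [in RHS]lnM ?posrE ?divr_gt0 ?ltr0n //; ring.
Qed.

(** Put h = ln M + gamma + e and y = M + r. The terms of order M ln M and M cancel; e M, r e and r
    gamma in [0, 1], r ln M in [0, ln M] and Stirling's error remain. *)
Lemma selberg_inner_bound (gamma y : R) M : 0 <= gamma <= 1 ->
  0 <= harmonic_sum R M - ln M%:R - gamma <= M%:R^-1 ->
  (0 < M)%N -> M%:R <= y < M.+1%:R ->
  `|ln_fact R M - y * harmonic_sum R M + (gamma + 1) * M%:R| <= 2 + ln y.
Proof.
move=> g01 H M0 /andP[My yM]; have Mp : 0 < M%:R :> R by rewrite ltr0n.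
have := stirling R M0; have := ln_nat_ge0 R M.
have : ln M%:R <= ln y by rewrite ler_ln ?posrE // (lt_le_trans Mp).
move: H; set h := harmonic_sum R M; set t := ln_fact R M; set l := ln M%:R.
case/andP=> e0; rewrite -div1r ler_pdivlMr // => e1 ly l0 /andP[t1 t2].
case/andP: g01 => g0 g1; rewrite -natr1 in yM.
pose e := h - l - gamma; have hE : h = e + l + gamma by rewrite /e; ring.
pose r := y - M%:R; have yE : y = M%:R + r by rewrite /r; ring.
have r0 : 0 <= r by rewrite /r; lra.
have r1 : r <= 1 by rewrite /r; lra.
have M1 : 1 <= M%:R :> R by rewrite ler1n.
have eM : e * M%:R <= 1 by [].
have e0' : 0 <= e by [].
have re : 0 <= r * e <= 1 by apply/andP; split; nra.
have rl : 0 <= r * l <= l by apply/andP; split; nra.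
have rg : 0 <= r * gamma <= 1 by apply/andP; split; nra.
have eM0 : 0 <= e * M%:R by rewrite mulr_ge0 // ltW.
have -> : t - y * h + (gamma + 1) * M%:R = (t - M%:R * l + M%:R) - e * M%:R
   - r * e - r * l - r * gamma by rewrite hE yE; ring.
rewrite ler_norml; apply/andP; split; lra.
Qed.

Lemma selberg N : (0 < N)%N ->
  `|psi N * ln N%:R + \sum_(1 <= n < N.+1) Lam n * psi (N %/ n)%N
    - 2 * N%:R * ln N%:R| <= 49 * N%:R.
Proof.
move=> N0; have Np : 0 < N%:R :> R by rewrite ltr0n.
have [gamma [g01 Hg]] := harmonic_bounds R.
pose f k : R := psi (N %/ k)%N - N%:R / k%:R + (gamma + 1).
have := tatuzawa_iseki f N0; set E := (X in _ = X) => fE.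
have Ebound : `|E| <= 32 * N%:R.
  apply: le_trans (ler_norm_sum _ _ _) _.
  apply: (@le_trans _ _ (\sum_(1 <= d < N.+1) 16 * (Num.sqrt N%:R / Num.sqrt d%:R))).
    rewrite big_nat [X in _ <= X]big_nat; apply: ler_sum => d /andP[d0 dN].
    have dp : 0 < d%:R :> R by rewrite ltr0n.
    have M0 : (0 < N %/ d)%N by rewrite divn_gt0.
    set y : R := N%:R / d%:R.
    have yM : (N %/ d)%:R <= y < (N %/ d).+1%:R.
      by rewrite ler_pdivlMr // ltr_pdivrMr // -!natrM ler_nat ltr_nat
        leq_divM ltn_ceil.
    have y1 : 1 <= y by case/andP: yM => h _; apply: le_trans h; rewrite ler1n.
    have -> : \sum_(1 <= m < (N %/ d).+1) f (d * m)%N =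
        ln_fact R (N %/ d) - y * harmonic_sum R (N %/ d) + (gamma + 1) * (N %/ d)%:R.
      rewrite /f !big_split /= sumrN; congr (_ - _ + _).
      - by rewrite -sum_psi_div; apply: eq_bigr => m _; rewrite divnMA.
      - rewrite /harmonic_sum big_distrr /=; apply: eq_bigr => m _.
        by rewrite natrM invfM mulrA.
      - by rewrite -big_split big_const_nat subSS subn0 iter_addr_0 mulr_natr.
    have := @selberg_inner_bound gamma y (N %/ d) g01 (Hg _ M0) M0 yM.
    set S := (X in `|X| <= _) => Sb.
    have ly : 0 <= ln y by rewrite ln_ge0.
    rewrite !normrM (ger0_norm ly) -mulrA.
    have := norm_moebius R d; have := normr_ge0 S; have := normr_ge0 (moebius R d).
    have := ln_quadratic_sqrt y1.
    have -> : Num.sqrt y = Num.sqrt N%:R / Num.sqrt d%:R.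
      by rewrite /y sqrtrM ?ler0n // sqrtrV ?ler0n.
    move=> h1 h2 h3 h4.
    apply: le_trans h1.
    have h5 : ln y * `|S| <= ln y * (2 + ln y) by rewrite ler_wpM2l.
    have h6 : 0 <= ln y * `|S| by rewrite mulr_ge0.
    nra.
  rewrite -big_distrr /= -big_distrr /=.
  have := sum_invsqrt N; set s := \sum_(_ <= _ < _) _ => hs.
  have sN : Num.sqrt N%:R * Num.sqrt N%:R = N%:R :> R by rewrite -expr2 sqr_sqrtr // ltW.
  have := sqrtr_ge0 (N%:R : R); move: sN hs; set q := Num.sqrt N%:R; nra.
have f1 : f 1%N = psi N - N%:R + (gamma + 1) by rewrite /f divn1 divr1.
have fs : \sum_(1 <= n < N.+1) Lam n * f n =
   \sum_(1 <= n < N.+1) Lam n * psi (N %/ n)%N - N%:R * mertens_sum R N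
   + (gamma + 1) * psi N.
  rewrite /f /mertens_sum [psi N]/chebyshev_psi !big_distrr /= -sumrB -big_split /=.
  by apply: eq_bigr => n _; ring.
move: fE; rewrite f1 fs; set P := \sum_(1 <= n < N.+1) _ => fE.
have := mertens R N0; have := psi_le R N; have := psi_ge0 R N.
have : ln N%:R <= N%:R - 1 :> R by rewrite ln_le_subr1.
have := ln_nat_ge0 R N; move: Ebound; rewrite !ler_norml.
move: fE; set l := ln _; set p := psi N; set A := mertens_sum R N.
move=> fE /andP[E1 E2] l0 l1 p0 p1 /andP[A1 A2].
case/andP: g01 => g0 g1.
(* The constant is 49 = 32 + 5 + 12: the bound on E, Mertens' estimate times N, and the terms with
   the factor gamma + 1 <= 2. *)
have -> : p * l + P - 2 * N%:R * l = E + N%:R * (A - l) - (gamma + 1) * (l + p).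
  by rewrite -fE; ring.
have h1 : - (5 * N%:R) <= N%:R * (A - l) <= 5 * N%:R by apply/andP; split; nra.
have h2 : 0 <= (gamma + 1) * (l + p) <= 12 * N%:R by apply/andP; split; nra.
apply/andP; split; lra.
Qed.

End Selberg.

(** * Sums up to real bounds and Selberg's formula on short intervals *)

Section RealSums.
Variable R : realType.
Implicit Types (n : nat) (F G : nat -> R) (x y z : R).
Local Notation Lam := (mangoldt R).

(** Real bounds permit arguments such as x / n; the sum is empty for z < 1. *)
Definition psum F z : R := \sum_(1 <= n < (Num.truncn z).+1) F n.

Lemma psum_diffE F z z' : z <= z' ->
  psum F z' - psum F z =
  \sum_((Num.truncn z).+1 <= n < (Num.truncn z').+1) F n.
Proof.
move=> zz; have tt : (Num.truncn z <= Num.truncn z')%N by rewrite le_truncn.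
by rewrite /psum [X in X - _](@big_cat_nat _ _ _ (Num.truncn z).+1) //= addrAC subrr add0r.
Qed.

Lemma ler_psum_diff F G z z' : z <= z' ->
  (forall n, (0 < n)%N -> z < n%:R -> n%:R <= z' -> F n <= G n) ->
  psum F z' - psum F z <= psum G z' - psum G z.
Proof.
move=> zz FG; rewrite !psum_diffE // big_nat [X in _ <= X]big_nat.
apply: ler_sum => -[|n] // /andP[n1 n2]; apply: FG => //.
  by rewrite -truncn_le_nat.
by rewrite -truncn_gt_nat.
Qed.

Lemma psum0 z : psum (fun=> 0) z = 0.
Proof. by rewrite /psum big1. Qed.

Lemma ler_psum F G z :
  (forall n, (0 < n)%N -> n%:R <= z -> F n <= G n) -> psum F z <= psum G z.
Proof.
move=> FG; rewrite /psum big_nat [X in _ <= X]big_nat.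
by apply: ler_sum => -[|n] // /andP[_ n2]; apply: FG; rewrite // -truncn_gt_nat.
Qed.

Lemma psum_mono F z z' : (forall n, 0 <= F n) -> z <= z' -> psum F z <= psum F z'.
Proof.
move=> F0 zz; have := @ler_psum_diff (fun=> 0) F z z' zz (fun n _ _ _ => F0 n).
by rewrite !psum0; lra.
Qed.

Lemma psum_ge0 F z : (forall n, 0 <= F n) -> 0 <= psum F z.
Proof. by move=> F0; apply: sumr_ge0. Qed.

Lemma psumZ (a : R) F z : psum (fun n => a * F n) z = a * psum F z.
Proof. by rewrite /psum big_distrr. Qed.

Lemma psumD F G z : psum (fun n => F n + G n) z = psum F z + psum G z.
Proof. by rewrite /psum big_split. Qed.

Lemma psumB F G z : psum (fun n => F n - G n) z = psum F z - psum G z.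
Proof. by rewrite /psum sumrB. Qed.

Lemma truncn_divn x n : (0 < n)%N -> 0 <= x ->
  Num.truncn (x / n%:R) = (Num.truncn x %/ n)%N.
Proof.
move=> n0 x0; have np : 0 < n%:R :> R by rewrite ltr0n.
apply: truncn_def; have /andP[h1 h2] := truncn_itv x0.
rewrite ler_pdivlMr // ltr_pdivrMr // -!natrM; apply/andP; split.
  by apply: le_trans h1; rewrite ler_nat leq_divM.
by apply: lt_le_trans h2 _; rewrite ler_nat ltn_ceil.
Qed.

Local Notation psi := (psum Lam).
Local Notation A := (psum (fun n => Lam n / n%:R)).

Lemma psi_mono x y : x <= y -> psi x <= psi y.
Proof. by apply: psum_mono => n; exact: mangoldt_ge0. Qed.

Lemma truncn_bounds x : 1 <= x -> [/\ (0 < Num.truncn x)%N,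
  (Num.truncn x)%:R <= x, x <= (Num.truncn x)%:R + 1 &
  ln x <= ln (Num.truncn x)%:R + (Num.truncn x)%:R^-1].
Proof.
move=> x1; have x0 : 0 <= x by lra.
have /andP[h1 h2] := truncn_itv x0.
have N0 : (0 < Num.truncn x)%N by rewrite truncn_gt0.
split=> //; first by rewrite natr1 ltW.
have /andP[_] := ln_succ R N0.
have : ln x <= ln (Num.truncn x).+1%:R.
  by rewrite ler_ln ?posrE ?ltr0n // ?ltW //; lra.
by move: (_^-1) => u; lra.
Qed.

Lemma psi_le_real x : 0 <= x -> psi x <= 5 * x.
Proof.
move=> x0; have /andP[h1 _] := truncn_itv x0.
by have := psi_le R (Num.truncn x); rewrite /psum -/(chebyshev_psi R _); lra.
Qed.

Lemma mertens_real x : 1 <= x -> ln x - 6 <= A x <= ln x + 6.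
Proof.
move=> x1; have [N0 h1 h2 h3] := truncn_bounds x1.
have := mertens R N0; rewrite /psum -/(mertens_sum R _) ler_norml.
have : ln (Num.truncn x)%:R <= ln x.
  by rewrite ler_ln ?posrE ?ltr0n //; lra.
have : (Num.truncn x)%:R^-1 <= 1 :> R.
  by rewrite invf_le1 ?ltr0n // ler1n.
move: h3; move: (_^-1) => u h3 h4 h5 /andP[h6 h7].
by apply/andP; split; lra.
Qed.

Lemma selberg_real x : 1 <= x ->
  `|psi x * ln x + psum (fun n => Lam n * psi (x / n%:R)) x - 2 * x * ln x|
  <= 56 * x.
Proof.
move=> x1; have x0 : 0 <= x by lra.
have [N0 h1 h2 h3] := truncn_bounds x1.
have -> : psum (fun n => Lam n * psi (x / n%:R)) x =
  \sum_(1 <= n < (Num.truncn x).+1) Lam n * chebyshev_psi R (Num.truncn x %/ n).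
  apply: eq_big_nat => n /andP[n0 _].
  by rewrite {1}/psum truncn_divn.
have := selberg R N0; have := psi_le R (Num.truncn x).
have := psi_ge0 R (Num.truncn x).
rewrite [psi x]/psum -/(chebyshev_psi R _).
have l1 : ln x <= x - 1 by rewrite ln_le_subr1; lra.
have l0 : ln (Num.truncn x)%:R <= ln x.
  by rewrite ler_ln ?posrE ?ltr0n //; lra.
have l2 := ln_nat_ge0 R (Num.truncn x).
have N1 : 1 <= (Num.truncn x)%:R :> R by rewrite ler1n.
set P := \sum_(_ <= _ < _) _; set p := chebyshev_psi R _.
move: h1 h2 h3 l0 l2 N1; set N := (Num.truncn x)%:R; set l := ln N.
move=> h1 h2 h3 l0 l2 N1 p0 p1.
have d1 : N * (ln x - l) <= 1.
  rewrite -(@ler_pM2l _ N^-1) ?invr_gt0; last lra.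
  by rewrite mulKf ?mulr1; lra.
have -> : p * ln x + P - 2 * x * ln x = (p * l + P - 2 * N * l) + p * (ln x - l)
   - 2 * (x - N) * ln x - 2 * (N * (ln x - l)) by ring.
have d2 : 0 <= p * (ln x - l) <= 5 by apply/andP; split; nra.
have d3 : 0 <= (x - N) * ln x <= x - 1 by apply/andP; split; nra.
have d4 : 0 <= N * (ln x - l) by nra.
rewrite !ler_norml => /andP[s1 s2]; apply/andP; split; lra.
Qed.

(** Selberg's formula at y minus that at x, with errors 112 x and 56 x. Replacing ln y by ln x costs
    10 x next to psi(y) and 4 x next to 2 y. *)
Lemma selberg_diff x y : 1 <= x -> x <= y -> y <= 2 * x ->
  `|(psi y - psi x) * ln x + (psum (fun n => Lam n * psi (y / n%:R)) y -
     psum (fun n => Lam n * psi (x / n%:R)) x) - 2 * (y - x) * ln x| <= 182 * x.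
Proof.
move=> x1 xy y2; have := selberg_real x1; have := @selberg_real y ltac:(lra).
have := @psi_le_real y ltac:(lra); have : 0 <= psi y.
  by apply: psum_ge0 => n; exact: mangoldt_ge0.
have yx : 0 < y / x by rewrite divr_gt0; lra.
have : ln y - ln x <= y / x - 1.
  by rewrite -ln_div ?posrE ?ln_le_subr1 //; lra.
have : ln x <= ln y by rewrite ler_ln ?posrE; lra.
have : y / x <= 2 by rewrite ler_pdivrMr; lra.
set p := psi y; set q := psi x; set P := psum _ y; set Q := psum _ x.
rewrite !ler_norml; set l := ln x; set m := ln y; move: (y / x) => r.
move=> r2 lm mr p0 p5 /andP[s1 s2] /andP[t1 t2].
have -> : (p - q) * l + (P - Q) - 2 * (y - x) * l =
  (p * m + P - 2 * y * m) - (q * l + Q - 2 * x * l) - p * (m - l) + 2 * (y * (m - l)).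
  by ring.
have d1 : 0 <= p * (m - l) <= 10 * x by apply/andP; split; nra.
have d2 : 0 <= y * (m - l) <= 2 * x by apply/andP; split; nra.
apply/andP; split; lra.
Qed.

(** A bound of Brun-Titchmarsh type: the difference of double sums in [selberg_diff] is nonnegative
    and is dropped. Doubling 182 pays for the denominator 1 + ln x; for ln x <= 1 Chebyshev's bound
    suffices. *)
Lemma psi_diff_le x y : 1 <= x -> x <= y -> y <= 2 * x ->
  psi y - psi x <= 2 * (y - x) + 364 * x / (1 + ln x).
Proof.
move=> x1 xy y2; have l0 : 0 <= ln x by rewrite ln_ge0.
have [l1|l1] := lerP (ln x) 1.
  apply: (@le_trans _ _ (182 * x)).
    have := @psi_le_real y ltac:(lra); have : 0 <= psi x.
      by apply: psum_ge0 => n; exact: mangoldt_ge0.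
    by lra.
  have : 182 * x <= 364 * x / (1 + ln x) by rewrite ler_pdivlMr; nra.
  lra.
have : (psi y - psi x - 2 * (y - x)) * ln x <= 182 * x.
  have := selberg_diff x1 xy y2; rewrite ler_norml => /andP[_].
  have : 0 <= psum (fun n => Lam n * psi (y / n%:R)) y -
     psum (fun n => Lam n * psi (x / n%:R)) x.
    have F0 n : 0 <= Lam n * psi (y / n%:R).
      by rewrite mulr_ge0 ?mangoldt_ge0 // psum_ge0 // => k; exact: mangoldt_ge0.
    have := psum_mono F0 xy.
    have : psum (fun n => Lam n * psi (x / n%:R)) x <=
           psum (fun n => Lam n * psi (y / n%:R)) x.
      apply: ler_psum => n n0 _; rewrite ler_wpM2l ?mangoldt_ge0 // psi_mono //.
      by rewrite ler_pM2r // invr_gt0 ltr0n.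
    lra.
  move: (_ - psum _ x) => u; lra.
move=> h; rewrite -lerBlDl ler_pdivlMr; last lra.
set u := psi y - psi x - 2 * (y - x) in h *.
have [u0|u0] := lerP u 0; first by nra.
nra.
Qed.

Lemma psi_diff_le_eps (tau : R) : 0 < tau -> exists2 Z : R, 1 <= Z &
  forall x y, Z <= x -> x <= y -> y <= 2 * x ->
  psi y - psi x <= 2 * (y - x) + tau * x.
Proof.
move=> t0; exists (expR (364 / tau)); first by rewrite -expR0 ler_expR divr_ge0 // ltW.
move=> x y xZ xy y2.
have x1 : 1 <= x by apply: le_trans xZ; rewrite -expR0 ler_expR divr_ge0 // ltW.
apply: le_trans (psi_diff_le x1 xy y2) _; rewrite lerD2l ler_pdivrMr; last first.
  by have := ln_ge0 x1; lra.
have : 364 / tau <= ln x by rewrite -(expRK (364 / tau)) ler_ln ?posrE ?expR_gt0 //; lra.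
rewrite ler_pdivrMr // => h; nra.
Qed.

End RealSums.

(** * Prime powers in short intervals *)

Section PrimePowerGaps.
Variable R : realType.
Implicit Types (n i k : nat) (x y z c d : R).
Local Notation Lam := (mangoldt R).
Local Notation psi := (psum Lam).
Local Notation A := (psum (fun n => Lam n / n%:R)).

(** The shortfall of (x/n, (1+c)x/n] from the maximal density 2 of [psi_diff_le]. *)
Definition defect c x n : R :=
  2 * c * (x / n%:R) - (psi ((1 + c) * (x / n%:R)) - psi (x / n%:R)).

Definition pos_defect c x n : R := Lam n * Num.max (defect c x n) 0.

Lemma pos_defect_ge0 c x n : 0 <= pos_defect c x n.
Proof. by rewrite mulr_ge0 ?mangoldt_ge0 // le_max lexx orbT. Qed.

Definition prime_power_free c x :=
  forall n, x < n%:R -> n%:R <= (1 + c) * x -> Lam n = 0.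

(** Let y = (1+c)x. Without prime powers in (x, y], psi(y) - psi(x) vanishes and the difference of
    double sums carries all of 2 c x ln x; by Mertens this is the value for maximal density at all
    n. Here 194 = 182 + 12. *)
Lemma sum_defect_le c x : 0 < c <= 1 -> 1 <= x -> prime_power_free c x ->
  psum (fun n => Lam n * defect c x n) x <= 194 * x.
Proof.
case/andP=> c0 c1 x1 pf; set y := (1 + c) * x.
have xy : x <= y by rewrite /y; nra.
have y2 : y <= 2 * x by rewrite /y; nra.
have gap (F : nat -> R) : (forall n, Lam n = 0 -> F n = 0) -> psum F y <= psum F x.
  move=> F0; have := @ler_psum_diff R F (fun=> 0) x y xy.
  rewrite !psum0 subrr subr_le0; apply=> n _ n1 n2.
  by rewrite F0 // pf.
have h1 : psum (fun n => Lam n * psi (y / n%:R)) y <=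
          psum (fun n => Lam n * psi (y / n%:R)) x.
  by apply: gap => n ->; rewrite mul0r.
have h2 : psi y <= psi x by apply: gap.
have := selberg_diff x1 xy y2; rewrite ler_norml => /andP[h3 _].
have -> : psum (fun n => Lam n * defect c x n) x = 2 * c * x * A x -
   psum (fun n => Lam n * psi (y / n%:R)) x + psum (fun n => Lam n * psi (x / n%:R)) x.
  rewrite -psumZ -psumB -psumD; apply: eq_bigr => n _.
  by rewrite /defect /y -!mulrA; ring.
have := mertens_real x1; have := ln_ge0 x1; have := psi_mono xy.
move: h3; rewrite [y - x](_ : _ = c * x); last by rewrite /y; ring.
move=> h3 h4 l0 /andP[_ a2].
have cx : 0 <= c * x <= x by apply/andP; split; nra.
have : c * x * (A x - ln x) <= 6 * x.
  by apply: (@le_trans _ _ (c * x * 6)); [rewrite ler_wpM2l; lra | lra].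
have : (psi y - psi x) * ln x <= 0 by rewrite mulr_le0_ge0 // subr_le0.
lra.
Qed.

(** Split at x / exp B: below, the last factor is at most 1 / (1 + B); above, it is at most 1 and
    Mertens bounds the remaining weights by B + 12. *)
Lemma sum_inv_ln_le (B x : R) : 0 <= B -> expR B <= x ->
  psum (fun n => Lam n / n%:R / (1 + ln (x / n%:R))) x <=
  (ln x + 6) / (1 + B) + B + 12.
Proof.
move=> B0 Bx; have eB : 1 <= expR B by rewrite -expR0 ler_expR.
have x1 : 1 <= x by lra.
have x0 : 0 < x by lra.
set z := x / expR B; have z1 : 1 <= z by rewrite ler_pdivlMr ?expR_gt0 // mul1r.
have zx : z <= x by rewrite ler_pdivrMr ?expR_gt0 //; nra.
have lz : ln z = ln x - B by rewrite ln_div ?posrE ?expR_gt0 // expRK.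
have L0 n : (0 < n)%N -> 0 <= Lam n / n%:R by move=> n0; rewrite divr_ge0 ?mangoldt_ge0.
have h1 : psum (fun n => Lam n / n%:R / (1 + ln (x / n%:R))) z <= A z / (1 + B).
  rewrite mulrC -psumZ; apply: ler_psum => n n0 nz.
  have np : 0 < n%:R :> R by rewrite ltr0n.
  have Bl : B <= ln (x / n%:R).
    rewrite -[X in X <= _](@expRK R) ler_ln ?posrE ?expR_gt0 ?divr_gt0 //.
    by rewrite ler_pdivlMr // mulrC -ler_pdivlMr ?expR_gt0.
  rewrite mulrC ler_wpM2r ?L0 // lef_pV2 ?posrE; lra.
have h2 : psum (fun n => Lam n / n%:R / (1 + ln (x / n%:R))) x -
   psum (fun n => Lam n / n%:R / (1 + ln (x / n%:R))) z <= A x - A z.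
  apply: ler_psum_diff => // n n0 _ nx.
  have np : 0 < n%:R :> R by rewrite ltr0n.
  have : 0 <= ln (x / n%:R) by rewrite ln_ge0 // ler_pdivlMr // mul1r.
  have := L0 n n0; move: (Lam n / _) (ln _) => u v u0 v0.
  by rewrite ler_pdivrMr; nra.
have := mertens_real x1; have := mertens_real z1; rewrite lz => /andP[a1 a2] /andP[a3 a4].
have h3 : A z / (1 + B) <= (ln x + 6) / (1 + B).
  by rewrite ler_pM2r ?invr_gt0; lra.
lra.
Qed.

(** With w = x / n, [psi_diff_le] makes the defect plus 364 w / (1 + ln w) nonnegative, so this sum
    dominates the positive part. The added terms total at most eps x ln x + O(x). *)
Lemma sum_pos_defect_le (eps : R) : 0 < eps -> exists2 K : R, 1 <= K &
  forall c x, 0 < c <= 1 -> K <= x -> prime_power_free c x ->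
  psum (pos_defect c x) x <= (eps * ln x + K) * x.
Proof.
move=> e0; pose B := 364 / eps.
have B0 : 0 < B by rewrite divr_gt0.
pose K := expR B + 194 + 364 * (6 + B + 12).
have eB : 0 < expR B by exact: expR_gt0.
exists K; first by rewrite /K; lra.
move=> c x c01 Kx pf; have /andP[c0 c1] := c01.
have x1 : 1 <= x by rewrite /K in Kx; lra.
have x0 : 0 < x by lra.
have Bx : expR B <= x by rewrite /K in Kx; lra.
have h1 := sum_defect_le c01 x1 pf.
have h2 := @sum_inv_ln_le B x (ltW B0) Bx.
apply: (@le_trans _ _ (psum (fun n => Lam n * defect c x n +
    364 * x * (Lam n / n%:R / (1 + ln (x / n%:R)))) x)).
  apply: ler_psum => n n0 nx.
  have np : 0 < n%:R :> R by rewrite ltr0n.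
  set w := x / n%:R; have w1 : 1 <= w by rewrite ler_pdivlMr // mul1r.
  have l0 : 0 <= ln w by rewrite ln_ge0.
  have g1 : 0 <= defect c x n + 364 * w / (1 + ln w).
    have := @psi_diff_le R w ((1 + c) * w) w1; rewrite /defect -/w.
    move=> /(_ ltac:(nra) ltac:(nra)).
    by move: (psi _) (psi _) (_ / _) => u v t; lra.
  have g2 : 0 <= 364 * w / (1 + ln w) by rewrite divr_ge0; lra.
  have -> : 364 * x * (Lam n / n%:R / (1 + ln w)) = Lam n * (364 * w / (1 + ln w)).
    by rewrite /w; ring.
  rewrite -mulrDr ler_wpM2l ?mangoldt_ge0 // ge_max; apply/andP; split; lra.
rewrite psumD psumZ; set S := psum _ x in h2 *.
have l0 : 0 <= ln x by rewrite ln_ge0.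
have h3 : 364 * ((ln x + 6) / (1 + B)) <= eps * ln x + 364 * 6.
  rewrite mulrA ler_pdivrMr; last lra.
  have : eps * B = 364 by rewrite /B mulrC divfK // lt0r_neq0.
  nra.
have h4 : 364 * x * S <= 364 * x * ((ln x + 6) / (1 + B) + B + 12).
  by rewrite ler_pM2l //; lra.
have h5 : x * (364 * ((ln x + 6) / (1 + B))) <= x * (eps * ln x + 364 * 6).
  by rewrite ler_pM2l.
have h6 : 0 <= x * expR B by rewrite mulr_ge0 // ltW.
rewrite /K; move: (psum _ x) h1 h4 h5 => D h1; move: ((ln x + 6) / (1 + B)) => q h4 h5.
nra.
Qed.

(** t = 1 is the density predicted by the prime number theorem; the thresholds used are 1/2 and
    3/2. *)
Definition active (t d z : R) := t * d * z <= psi ((1 + d) * z) - psi z.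

(* Some [n] in (z, (1+d)z] has a small defect, so (x/n, (1+c)x/n] has almost the
   maximal density 2, hence so has each of its subintervals (z', (1+d)z']. *)
Lemma reflect_active c d x z z' Z : 0 < c <= 1 -> 0 < d <= 1 -> 0 < z -> 1 <= Z ->
  (forall x y, Z <= x -> x <= y -> y <= 2 * x ->
     psi y - psi x <= 2 * (y - x) + d / 12 * x) ->
  active 2^-1 d z -> Z <= x / ((1 + d) * z) ->
  psum (pos_defect c x) ((1 + d) * z) - psum (pos_defect c x) z < d ^+ 2 / 16 * x ->
  x / z <= z' -> (1 + d) * z' <= (1 + c) * (x / ((1 + d) * z)) ->
  active (3 / 2) d z'.
Proof.
move=> /andP[c0 c1] /andP[d0 d1] z0 Z1 U az Zx small z'1 z'2.
have x0 : 0 < x.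
  have : 0 < x / ((1 + d) * z) by lra.
  by rewrite pmulr_lgt0 // invr_gt0 mulr_gt0 //; lra.
have dz : z <= (1 + d) * z by nra.
have dz0 : 0 < (1 + d) * z by nra.
(* Otherwise every [Lam n] of the cell has a factor at least d/4 * x/((1+d)z), and activity forces a
   total of at least d^2/16 * x. *)
have [n [n1 n2 ng]] : exists n, [/\ z < n%:R, n%:R <= (1 + d) * z &
    defect c x n < d / 4 * (x / n%:R)].
  apply/not_existsP => H; move: small; apply/negP; rewrite -leNgt.
  apply: (@le_trans _ _ (d / 4 * (x / ((1 + d) * z)) * (psi ((1 + d) * z) - psi z))).
    have q0 : 0 < x / ((1 + d) * z) by rewrite divr_gt0.
    apply: (@le_trans _ _ (d / 4 * (x / ((1 + d) * z)) * (2^-1 * d * z))).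
      have -> : d / 4 * (x / ((1 + d) * z)) * (2^-1 * d * z) = d ^+ 2 / 16 * x * (2 / (1 + d)).
        by field; apply/andP; split; lra.
      rewrite -[X in X <= _]mulr1 ler_wpM2l //; first by nra.
      by rewrite ler_pdivlMr; lra.
    by rewrite ler_pM2l // mulr_gt0 //; lra.
  rewrite mulrBr -!psumZ; apply: ler_psum_diff => // n n0 n1 n2.
  have np : 0 < n%:R :> R by rewrite ltr0n.
  rewrite /pos_defect mulrC ler_wpM2l ?mangoldt_ge0 // le_max; apply/orP; left.
  rewrite leNgt; apply/negP => h; apply: (H n); split=> //.
  apply: lt_le_trans h _; rewrite ler_pM2l; last by lra.
  by rewrite ler_pM2l // lef_pV2 ?posrE.
have np : 0 < n%:R :> R by lra.
pose w := x / n%:R.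
have w0 : 0 < w by rewrite divr_gt0.
have w1 : x / ((1 + d) * z) <= w by rewrite ler_pM2l // lef_pV2 ?posrE.
have w2 : w <= x / z by rewrite ler_pM2l // lef_pV2 ?posrE // ltW.
have w3 : (1 + d) * z' <= (1 + c) * w by nra.
have wz : w <= z' by lra.
have z'0 : 0 < z' by lra.
have zz : z' <= (1 + d) * z' by nra.
(* The pieces (w, z'] and ((1+d)z', (1+c)w] have density at most 2, up to d/12 times their left
   ends. The losses d/4, d/12 and (1+d)d/12 <= d/6 add up to d/2, which leaves 3/2. *)
have := U w z' ltac:(lra) wz ltac:(nra).
have := U ((1 + d) * z') ((1 + c) * w) ltac:(lra) w3 ltac:(nra).
move: ng; rewrite /defect -/w /active.
move: (psi _) (psi _) (psi _) (psi _) => p1 p2 p3 p4 h1 h2 h3.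
nra.
Qed.

End PrimePowerGaps.

(** * Propagation of density and existence of prime powers *)

Section PrimePowersInShortIntervals.
Variable R : realType.
Implicit Types (n i k s L M J : nat) (x y z c d : R).
Local Notation Lam := (mangoldt R).
Local Notation psi := (psum Lam).
Local Notation A := (psum (fun n => Lam n / n%:R)).

Lemma inactive_mertens d z : 0 < d -> 0 < z -> ~~ (2^-1 * d * z <= psi ((1 + d) * z) - psi z) ->
  A ((1 + d) * z) - A z <= 2^-1 * d.
Proof.
move=> d0 z0; rewrite -ltNge => h; have zz : z <= (1 + d) * z by nra.
apply: (@le_trans _ _ (z^-1 * (psi ((1 + d) * z) - psi z))).
  rewrite mulrBr -!psumZ; apply: ler_psum_diff => // n n0 n1 _.
  rewrite mulrC ler_wpM2r ?mangoldt_ge0 // lef_pV2 ?posrE ?ltW //.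
  exact: lt_trans z0 n1.
by rewrite ler_pdivrMl // (mulrC z) ltW.
Qed.

(** Here 21/16 = 3/2 * 7/8, as 1/(1+d) >= 7/8. Since ln (1+d) lies in [7/8 d, d], inactive cells
    stay below Mertens' average (1/2 < 7/8) and these exceed it (21/16 > 1). *)
Lemma active_mertens d z : 0 < d <= 7^-1 -> 0 < z -> active (3 / 2) d z ->
  21 / 16 * d <= A ((1 + d) * z) - A z.
Proof.
move=> /andP[d0 d1] z0; rewrite /active => h; have zz : z <= (1 + d) * z by nra.
have dz0 : 0 < (1 + d) * z by nra.
apply: (@le_trans _ _ (((1 + d) * z)^-1 * (psi ((1 + d) * z) - psi z))).
  rewrite ler_pdivlMl //; apply: le_trans h; nra.
rewrite mulrBr -!psumZ; apply: ler_psum_diff => // n n0 n1 n2.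
rewrite mulrC ler_wpM2l ?mangoldt_ge0 // lef_pV2 ?posrE //.
exact: lt_trans z0 n1.
Qed.

Lemma ln_succ_bounds d : 0 < d <= 7^-1 -> 7 / 8 * d <= ln (1 + d) <= d.
Proof.
move=> /andP[d0 d1]; have p0 : 0 < 1 + d by lra.
have := ln_le_subr1 p0; have := ln_ge_subV p0 => h1 h2.
have h3 : (1 + d)^-1 <= 1 - 7 / 8 * d by rewrite -div1r ler_pdivrMr //; nra.
by apply/andP; split; lra.
Qed.

(* Activity passes from z to x/z and from there to (1+d)z; by Mertens one of the
   first J cells is active, so all of the last J ones are too dense. *)
Lemma no_window c d x Z J a : 0 < c <= 1 -> 0 < d <= 7^-1 ->
  (1 + d) ^+ 3 <= 1 + c -> 40 < J%:R * d -> 1 <= Z ->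
  (forall x y, Z <= x -> x <= y -> y <= 2 * x ->
     psi y - psi x <= 2 * (y - x) + d / 12 * x) ->
  Z * (1 + d) <= (1 + d) ^+ a -> Z <= x / (1 + d) ^+ (a + J + J) ->
  (forall i, (a <= i < a + J + J)%N ->
    psum (pos_defect c x) ((1 + d) ^+ i.+1) - psum (pos_defect c x) ((1 + d) ^+ i)
      < d ^+ 2 / 16 * x /\
    psum (pos_defect c x) ((1 + d) * (x / (1 + d) ^+ i)) -
      psum (pos_defect c x) (x / (1 + d) ^+ i) < d ^+ 2 / 16 * x) ->
  False.
Proof.
move=> c01 d01 dc Jd Z1 U Za Zx small.
case/andP: (d01) => d0 d1; have d1' : 0 < d <= 1 by apply/andP; split; lra.
have b0 : 0 < 1 + d by lra.
have bp i : 0 < (1 + d) ^+ i by rewrite exprn_gt0.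
have b1 i : 1 <= (1 + d) ^+ i by rewrite exprn_ege1 //; lra.
have bm i j : (i <= j)%N -> (1 + d) ^+ i <= (1 + d) ^+ j.
  by move=> ij; rewrite ler_weXn2l //; lra.
have x0 : 0 < x.
  have : 0 < x / (1 + d) ^+ (a + J + J) by lra.
  by rewrite pmulr_lgt0 // invr_gt0.
have step i : (a <= i < a + J + J)%N -> active 2^-1 d ((1 + d) ^+ i) ->
    active (3 / 2) d ((1 + d) ^+ i.+1).
  move=> iJ ai; have [P1 P2] := small i iJ; case/andP: iJ => i1 i2.
  have z0 := bp i; have Zi : Z * (1 + d) <= (1 + d) ^+ i by apply: le_trans (bm _ _ i1).
  have Zxi : Z <= x / ((1 + d) * (1 + d) ^+ i).
    apply: le_trans Zx _; rewrite -exprS ler_pM2l // lef_pV2 ?posrE //; exact: bm.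
  rewrite exprS in P1 *; move: ((1 + d) ^+ i) ai z0 Zi P1 P2 Zxi => z ai z0 Zi P1 P2 Zxi.
  have xz0 : 0 < x / z by rewrite divr_gt0.
  have a1 : active (3 / 2) d (x / z).
    apply: (@reflect_active R c d x z (x / z) Z) => //.
    have -> : x / z = (1 + d) * (x / ((1 + d) * z)).
      by field; apply/andP; split; apply: lt0r_neq0.
    rewrite mulrA ler_wpM2r //; [lra | nra].
  have a2 : active 2^-1 d (x / z).
    by move: a1; rewrite /active; apply: le_trans; nra.
  have e1 : x / ((1 + d) * (x / z)) = z / (1 + d).
    by field; rewrite !lt0r_neq0.
  (* Reflecting x/z back: the end (1+d)^2 z must stay below (1+c) z/(1+d), which is the hypothesis
     on (1+d)^3. *)
  apply: (@reflect_active R c d x (x / z) ((1 + d) * z) Z) => //.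
  - by rewrite e1 ler_pdivlMr.
  - by rewrite invf_div mulrC divfK ?lt0r_neq0 //; nra.
  - rewrite e1 [(1 + c) * _]mulrA ler_pdivlMr //.
    by apply: (@le_trans _ _ ((1 + d) ^+ 3 * z)); [rewrite le_eqVlt; apply/orP; left; apply/eqP; ring | rewrite ler_pM2r].
have /andP[lb1 lb2] := ln_succ_bounds d01.
have lnb i : ln ((1 + d) ^+ i) = i%:R * ln (1 + d) by rewrite lnXn // mulr_natl.
have J0 : 0 <= J%:R :> R by [].
have [|noact] := boolP [exists k : 'I_J, 2^-1 * d * (1 + d) ^+ (a + k) <=
     psi ((1 + d) * (1 + d) ^+ (a + k)) - psi ((1 + d) ^+ (a + k))]; last first.
  have cell k : (k <= J)%N -> A ((1 + d) ^+ (a + k)) - A ((1 + d) ^+ a) <= k%:R * (2^-1 * d).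
    elim: k => [|k IH] kJ; first by rewrite addn0 subrr mul0r.
    have := IH (ltnW kJ); move: noact; rewrite negb_exists => /forallP/(_ (Ordinal kJ)) /=.
    move=> /(inactive_mertens d0 (bp _)); rewrite addnS exprS -natr1; lra.
  (* If the first J cells are inactive, 7/8 J d - 12 <= J d / 2, so J d <= 32. *)
  have := cell J (leqnn J).
  have /andP[m1 m2] := mertens_real (b1 (a + J)%N).
  have /andP[m3 m4] := mertens_real (b1 a).
  move: m1 m4; rewrite !lnb natrD; nra.
case/existsP=> -[k kJ] /= act.
have strong j : (a + k < j <= a + J + J)%N -> active (3 / 2) d ((1 + d) ^+ j).
  case/andP; elim: j => // j IH; rewrite ltnS leq_eqVlt => /orP[/eqP <- jJ|kj jJ].
    by apply: step => //; rewrite leq_addr.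
  apply: step; first by rewrite jJ andbT (leq_trans _ (ltnW kj)) // leq_addr.
  have := IH kj (ltnW jJ); rewrite /active; apply: le_trans.
  by have := bp j; nra.
have cell j : (j <= J)%N ->
    j%:R * (21 / 16 * d) <= A ((1 + d) ^+ (a + J + j)) - A ((1 + d) ^+ (a + J)).
  elim: j => [|j IH] jJ; first by rewrite addn0 subrr mul0r.
  have jr : (a + k < a + J + j <= a + J + J)%N.
    by rewrite leq_add2l (ltnW jJ) andbT (leq_trans _ (leq_addr _ _)) // ltn_add2l.
  have h1 := IH (ltnW jJ).
  have h2 := @active_mertens d ((1 + d) ^+ (a + J + j)) d01 (bp _) (strong _ jr).
  move: h1 h2; rewrite addnS exprS -natr1; lra.
(* The last J cells give 21/16 J d <= J d + 12, so J d < 39, against 40 < J d. *)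
have := cell J (leqnn J).
have /andP[m1 m2] := mertens_real (b1 (a + J + J)%N).
have /andP[m3 m4] := mertens_real (b1 (a + J)%N).
move: m2 m3; rewrite !lnb [(a + J + J)%:R]natrD; nra.
Qed.

Lemma pigeonhole_increment (H : nat -> R) (t : R) s L M :
  H (s + M * L)%N - H s < M%:R * t ->
  exists2 k, (k < M)%N & H (s + k * L + L)%N - H (s + k * L)%N < t.
Proof.
elim: M => [|M IH]; first by rewrite mul0n addn0 subrr mul0r ltxx.
have [h _|h] := ltrP (H (s + M * L)%N - H s) (M%:R * t).
  by have [k kM hk] := IH h; exists k; rewrite // ltnW.
rewrite mulSn [(L + _)%N]addnC addnA -natr1 => h'; exists M => //; lra.
Qed.

Lemma nondecreasing_nat (H : nat -> R) : (forall i, H i <= H i.+1) ->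
  forall i j, (i <= j)%N -> H i <= H j.
Proof.
by move=> Hs i j /subnK <-; elim: (j - i)%N => // m IH; rewrite addSn (le_trans IH).
Qed.

Lemma exists_expr_ge (b y : R) : 1 < b -> exists s, y <= b ^+ s.
Proof.
move=> b1; have b0 : 0 < b by lra.
have [y0|y0] := lerP y 0; first by exists 0%N; rewrite expr0; lra.
have lb : 0 < ln b by rewrite ln_gt0.
exists (Num.truncn (ln y / ln b)).+1.
rewrite -ler_ln ?posrE ?exprn_gt0 // lnXn // -mulr_natl -ler_pdivrMr //.
by rewrite ltW // truncnS_gt.
Qed.

Theorem prime_power_in_short_interval (c : R) : 0 < c ->
  exists X : R, forall x, X <= x ->
  exists n, [/\ x < n%:R, n%:R <= (1 + c) * x & mangoldt R n != 0].
Proof.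
wlog c1 : c / c <= 1.
  move=> W c0; have [c1|c1] := lerP c 1; first exact: W.
  have [X HX] := W 1 (lexx _) ltr01; exists (Num.max X 0) => x.
  rewrite ge_max => /andP[/HX[n [n1 n2 n3]] x0]; exists n; split=> //; nra.
move=> c0; have c01 : 0 < c <= 1 by rewrite c0.
(* The factor 7 gives (1 + d)^3 <= 1 + 7 d for d <= 1. *)
pose d := c / 7; have d0 : 0 < d by rewrite divr_gt0.
have d01 : 0 < d <= 7^-1 by rewrite d0 /d; lra.
have b0 : 0 < 1 + d by lra.
have b1 : 1 < 1 + d by lra.
have dc : (1 + d) ^+ 3 <= 1 + c.
  have -> : c = 7 * d by rewrite /d; field.
  have d1 : d <= 1 by rewrite /d; lra.
  have d2 : d ^+ 2 <= d by rewrite expr2; nra.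
  have d3 : d ^+ 3 <= d by rewrite exprS; nra.
  have -> : (1 + d) ^+ 3 = 1 + 3 * d + 3 * d ^+ 2 + d ^+ 3 by ring.
  lra.
have [Z Z1 U] := @psi_diff_le_eps R (d / 12) ltac:(lra).
have [s Zs] := @exists_expr_ge (1 + d) (Z * (1 + d)) b1.
pose J := (Num.truncn (40 / d)).+1; pose L := (J + J)%N.
have Jd : 40 < J%:R * d by rewrite -ltr_pdivrMr // truncnS_gt.
pose l := ln (1 + d); have l0 : 0 < l by rewrite ln_gt0.
have Lp : 0 < L%:R :> R by rewrite ltr0n.
have Ll : 0 < L%:R * l by rewrite mulr_gt0.
(* A block of L cells has logarithmic length L l, so q x is the threshold d^2/16 * x per unit of ln
   x. The defects, counted twice with eps = q / 4, use up half of it. *)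
pose q := d ^+ 2 / 16 / (L%:R * l).
have q0 : 0 < q by rewrite !divr_gt0 // exprn_gt0.
have [K K1 HK] := @sum_pos_defect_le R (q / 4) ltac:(lra).
(* ln x - D is the logarithmic length of the range from (1 + d)^s to x / Z, into which M blocks will
   fit. *)
pose D := ln Z + s%:R * l.
have D0 : 0 <= D by rewrite addr_ge0 ?ln_ge0 // mulr_ge0 // ltW.
(* For ln x >= Y the additive terms stay below half of q ln x. *)
pose Y := 2 * (2 * K + q * D + d ^+ 2 / 16 + 1) / q.
exists (K + expR Y) => x Xx.
have eY := expR_gt0 Y; have Kx : K <= x by lra.
have x0 : 0 < x by lra.
have lx : Y <= ln x by rewrite -(expRK Y) ler_ln ?posrE //; lra.
apply: contrapT => none.
have pf : prime_power_free c x.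
  move=> n n1 n2; apply/eqP; apply: contraT => n3; exfalso.
  by apply: none; exists n.
have G := HK c x c01 Kx pf.
pose Gs := psum (pos_defect c x).
have Gm y z : y <= z -> Gs y <= Gs z by apply: psum_mono => n; exact: pos_defect_ge0.
have G0 y : 0 <= Gs y by apply: psum_ge0 => n; exact: pos_defect_ge0.
have GsE : Gs = psum (pos_defect c x) by [].
rewrite -GsE in G; clearbody Gs.
have qY : q * Y = 2 * (2 * K + q * D + d ^+ 2 / 16 + 1).
  by rewrite /Y mulrC divfK // lt0r_neq0.
have dd : 0 <= d ^+ 2 / 16 by rewrite divr_ge0 // sqr_ge0.
have qlx : q * Y <= q * ln x by rewrite ler_pM2l.
have qD : 0 <= q * D by rewrite mulr_ge0 // ltW.
have Dx : D <= ln x.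
  by rewrite -(ler_pM2l q0); move: qlx qY qD dd K1; clear=> *; lra.
pose M := Num.truncn ((ln x - D) / (L%:R * l)).
have M1 : M%:R * (L%:R * l) <= ln x - D.
  by rewrite -ler_pdivlMr // truncn_le divr_ge0 ?subr_ge0 // ltW.
have M2 : (ln x - D) / (L%:R * l) < M%:R + 1 by rewrite natr1 truncnS_gt.
have bp i : 0 < (1 + d) ^+ i by rewrite exprn_gt0.
have bm i j : (i <= j)%N -> (1 + d) ^+ i <= (1 + d) ^+ j.
  by move=> ij; rewrite ler_weXn2l //; lra.
have top : Z <= x / (1 + d) ^+ (s + M * L).
  rewrite ler_pdivlMr // -ler_ln ?posrE ?mulr_gt0 //; last lra.
  rewrite lnM ?posrE //; last lra.
  rewrite lnXn // -mulr_natl natrD natrM -/l; move: M1; rewrite /D; lra.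
(* An increment of [H] is the weight of the cell at (1 + d)^i plus that of its reflection at x / (1
   + d)^i. Both are nonnegative, so one small increment bounds both. *)
pose H i := Gs ((1 + d) ^+ i) - Gs ((1 + d) * (x / (1 + d) ^+ i)).
have shift i : (1 + d) * (x / (1 + d) ^+ i.+1) = x / (1 + d) ^+ i.
  by rewrite exprS; field; rewrite !lt0r_neq0.
have P1 i : Gs ((1 + d) ^+ i) <= Gs ((1 + d) ^+ i.+1) by apply: Gm; apply: bm.
have P2 i : Gs (x / (1 + d) ^+ i) <= Gs ((1 + d) * (x / (1 + d) ^+ i)).
  by apply: Gm; rewrite ler_peMl ?divr_ge0 // ltW.
have Hs i : H i <= H i.+1 by rewrite /H shift lerB.
have Hm := nondecreasing_nat Hs.
have big : H (s + M * L)%N - H s < M%:R * (d ^+ 2 / 16 * x).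
  have bs : 1 + d <= (1 + d) ^+ s by apply: le_trans Zs; rewrite ler_peMl // ltW.
  have h1 : Gs ((1 + d) ^+ (s + M * L)) <= Gs x.
    apply: Gm; move: top; rewrite ler_pdivlMr //; apply: le_trans.
    by rewrite ler_peMl // ltW.
  have h2 : Gs ((1 + d) * (x / (1 + d) ^+ s)) <= Gs x.
    apply: Gm; rewrite mulrCA -[X in _ <= X]mulr1 ler_pM2l //.
    by rewrite ler_pdivrMr // mul1r.
  have h3 : H (s + M * L)%N - H s <= 2 * Gs x.
    move: h1 h2 (G0 ((1 + d) ^+ s)) (G0 ((1 + d) * (x / (1 + d) ^+ (s + M * L)))).
    rewrite /H; move: (Gs _) (Gs _) (Gs _) (Gs _) (Gs _); clear=> *; lra.
  apply: le_lt_trans h3 _.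
  have : d ^+ 2 / 16 * ((ln x - D) / (L%:R * l)) <= d ^+ 2 / 16 * (M%:R + 1).
    by rewrite ler_wpM2l // ltW.
  have -> : d ^+ 2 / 16 * ((ln x - D) / (L%:R * l)) = q * (ln x - D).
    by rewrite /q; field; rewrite !lt0r_neq0.
  move=> h4; apply: (@le_lt_trans _ _ (2 * ((q / 4 * ln x + K) * x))).
    by rewrite ler_pM2l.
  rewrite mulrA (mulrA M%:R) ltr_pM2r //.
  move: h4 qlx qY qD dd K1; move: (d ^+ 2 / 16) (ln x) (q * Y) => e u v.
  by rewrite mulrBr; clear=> *; lra.
have [k kM hk] := pigeonhole_increment big.
apply: (@no_window c d x Z J (s + k * L)) => //.
- by apply: le_trans Zs _; apply: bm; rewrite leq_addr.
- apply: le_trans top _; rewrite ler_pM2l // lef_pV2 ?posrE //; apply: bm.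
  by rewrite -!addnA leq_add2l -/L -mulSnr leq_mul2r kM orbT.
move=> i /andP[i1 i2].
have : H i.+1 - H i < d ^+ 2 / 16 * x.
  apply: le_lt_trans hk; rewrite lerB // Hm //.
  by rewrite /L addnA.
rewrite -GsE /H shift; move: (P1 i) (P2 i).
by move: (Gs _) (Gs _) (Gs _) (Gs _); clear=> *; split; lra.
Qed.

End PrimePowersInShortIntervals.

(** * Asymptotics *)

Lemma powR_3half (R : realType) (a : R) : 0 <= a -> a `^ (3 / 2) = Num.sqrt a ^+ 3.
Proof.
move=> a0; have -> : 3 / 2 = 2^-1 * 3%:R :> R by rewrite mulrC.
by rewrite powRrM powR12_sqrt // powR_mulrn // sqrtr_ge0.
Qed.

(** For y = sqrt (n/2), a prime power q in (y/(1+c), y] has 2 q^2 <= n and gives at least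
    y^3/(1+c)^3 colours. With c = eta/7, (1+c)^3 <= 1 + eta and (1 - eta)(1 + eta) <= 1. *)
Lemma ar_star_lower (R : realType) (eta : R) : 0 < eta ->
  exists N, forall n, (N <= n)%N ->
  (1 - eta) * (n%:R / 2) `^ (3 / 2) <= (ar_star n K5_minus)%:R.
Proof.
move=> eta0; have [eta1|eta1] := lerP 1 eta.
  exists 0%N => n _; apply: (@le_trans _ _ 0) => //.
  by rewrite mulr_le0_ge0 ?powR_ge0 // subr_le0.
pose c := eta / 7; have c0 : 0 < c by rewrite divr_gt0.
have c1 : c <= 7^-1 by rewrite /c; lra.
have [X HX] := prime_power_in_short_interval c0.
(* n >= B gives y >= 2 |X|, hence y / (1 + c) >= X. *)
pose B := 2 * (2 * `|X|) ^+ 2; exists (Num.truncn B).+1 => n Nn.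
have Bn : B <= n%:R.
  by apply: le_trans (ltW (truncnS_gt B)) _; rewrite ler_nat.
have n20 : 0 <= (n%:R / 2 : R) by rewrite divr_ge0.
rewrite powR_3half //; set y := Num.sqrt _.
have y0 : 0 <= y by exact: sqrtr_ge0.
have y2 : y ^+ 2 = n%:R / 2 by rewrite sqr_sqrtr.
have Xy : 2 * `|X| <= y.
  rewrite -(@ler_pXn2r _ 2) ?nnegrE ?mulr_ge0 // y2 ler_pdivlMr //.
  by rewrite mulrC.
have [q [q1 q2 q3]] : exists q, [/\ y / (1 + c) < q%:R,
    q%:R <= (1 + c) * (y / (1 + c)) & mangoldt R q != 0].
  apply: HX; rewrite ler_pdivlMr; last lra.
  have := ler_norm X; have := normr_ge0 X; move: (`|X|) Xy => u; nra.
have [p [k [pp k0 qE]]] := mangoldt_neq0 q3.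
have [F _ cF] := finfield.pPrimePowerField pp k0.
have qy : q%:R <= y by move: q2; rewrite mulrC divfK //; apply: lt0r_neq0; lra.
have [s sf qs] : exists2 s, star_rainbow_free_with n K5_minus s & (q ^ 3 <= s)%N.
  rewrite qE -cF; apply: star_rainbow_free_affine_plane; rewrite cF -qE.
  rewrite -(ler_nat R) natrM natrX.
  have : q%:R ^+ 2 <= y ^+ 2 by rewrite ler_pXn2r ?nnegrE.
  by rewrite y2; lra.
apply: (@le_trans _ _ (q ^ 3)%:R); last first.
  by rewrite ler_nat (leq_trans qs) // ar_star_ub.
rewrite natrX; apply: (@le_trans _ _ ((y / (1 + c)) ^+ 3)); last first.
  by rewrite ler_pXn2r ?nnegrE // ?divr_ge0 //; lra.
rewrite expr_div_n ler_pdivlMr; last by rewrite exprn_gt0 //; lra.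
have cE : (1 + c) ^+ 3 <= 1 + eta.
  have -> : eta = 7 * c by rewrite /c; field.
  have c2 : c ^+ 2 <= c by rewrite expr2; nra.
  have c3 : c ^+ 3 <= c by rewrite exprS; nra.
  have -> : (1 + c) ^+ 3 = 1 + 3 * c + 3 * c ^+ 2 + c ^+ 3 by ring.
  lra.
rewrite mulrAC -[X in _ <= X]mul1r ler_wpM2r ?exprn_ge0 //.
apply: (@le_trans _ _ ((1 - eta) * (1 + eta))); last by nra.
by rewrite ler_wpM2l //; lra.
Qed.

(** 4 n^3 = 32 (n/2)^3 <= 16^2 (n/2)^3, for every n. *)
Lemma ar_star_upper (R : realType) (n : nat) :
  (ar_star n K5_minus)%:R <= 16 * (n%:R / 2 : R) `^ (3 / 2).
Proof.
have n20 : 0 <= (n%:R / 2 : R) by rewrite divr_ge0.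
rewrite powR_3half //; set y := Num.sqrt _.
have y0 : 0 <= y by exact: sqrtr_ge0.
have y2 : y ^+ 2 = n%:R / 2 by rewrite sqr_sqrtr.
have B0 : 0 <= 16 * y ^+ 3 by rewrite mulr_ge0 // exprn_ge0.
rewrite -truncn_ge_nat //; apply/bigmax_leqP => s /asboolP/colours_sqr_le sn.
rewrite truncn_ge_nat // -(@ler_pXn2r _ 2) ?nnegrE // -natrX.
apply: (@le_trans _ _ (4 * n ^ 3)%:R); first by rewrite ler_nat.
rewrite natrM natrX exprMn -exprM (exprM y 2 3) y2 expr_div_n.
by have : 0 <= n%:R ^+ 3 :> R by [rewrite exprn_ge0]; lra.
Qed.

Unset Implicit Arguments.

Theorem theorem1p7 (R : realType) :
  (exists eps : nat -> R,
    eps n @[n --> \oo] --> (0 : R) /\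
    \forall n \near \oo,
      (1 + eps n) * (n%:R / 2) `^ (3 / 2) <= (ar_star n K5_minus)%:R) /\
  (exists eps : nat -> R,
    eps n @[n --> \oo] --> (0 : R) /\
    \forall n \near \oo,
      (ar_star n K5_minus)%:R <= (1 + eps n) * 16 * (n%:R / 2) `^ (3 / 2)).
Proof.
split.
  (* The relative error capped at 0: the inequality holds by construction for n > 0, and
     [ar_star_lower] gives the convergence. *)
  pose eps n : R := Num.min 0 ((ar_star n K5_minus)%:R / (n%:R / 2) `^ (3 / 2) - 1).
  have pos n : (0 < n)%N -> 0 < (n%:R / 2 : R) `^ (3 / 2).
    by move=> n0; rewrite powR_gt0 // divr_gt0 // ltr0n.
  exists eps; split.
    apply/cvgrPdist_le => e e0; have [N HN] := ar_star_lower e0.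
    exists N.+1 => // n /= Nn; have n0 : (0 < n)%N by exact: leq_ltn_trans Nn.
    rewrite sub0r normrN ler_norml; apply/andP; split.
      rewrite le_min oppr_le0 ltW //= lerBrDl ler_pdivlMr ?pos //.
      by apply: HN; exact: ltnW.
    by rewrite ge_min ltW.
  exists 1%N => // n /= n0; rewrite -ler_pdivlMr ?pos // -lerBrDl.
  by rewrite ge_min lexx orbT.
exists (fun=> 0); split; first exact: cvg_cst.
by exists 0%N => // n _; rewrite addr0 mul1r; exact: ar_star_upper.
Qed.
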